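(* Let $\mathsf{P}:\mathscr{C}^{\mathrm{op}}\to\mathsf{InfSL}$ be a biased elementary doctrine. Then the biased elementary quotient completion $\overline{\mathsf{P}}:\overline{\mathscr{C}}^{\mathrm{op}}\to\mathsf{InfSL}$ is a (strict) elementary doctrine with effective quotients of effective descent (i.e. every $\overline{\mathsf{P}}$-equivalence relation has a quotient, which is effective and of effective descent). Moreover, if $\mathsf{P}$ has weak full comprehensions and comprehensive diagonals, then $\overline{\mathsf{P}}$ has strict full comprehensions, comprehensive diagonals and stable quotients.
   Context: **Weak products.** A weak product of objects $X_1,\dots,X_n$ is an object $W$ with arrows $\mathsf{p}_i:W\to X_i$ such that for all arrows $f_i:Z\to X_i$ there is a (not necessarily unique) $h:Z\to W$ with $\mathsf{p}_ih=f_i$ for all $i$. $\mathscr{C}$ has weak finite products if every finite list of objects has a weak product (the empty list giving a weak terminal object). **Biased primary doctrine.** $\mathsf{InfSL}$ is the category of posets with finite meets and finite-meet-preserving maps. A biased primary doctrine is a functor $\mathsf{P}:\mathscr{C}^{\mathrm{op}}\to\mathsf{InfSL}$ with $\mathscr{C}$ having weak finite products. For $f:X\to Y$ write $\mathsf{P}_f:\mathsf{P}(Y)\to\mathsf{P}(X)$; $\top_X$ is the top of $\mathsf{P}(X)$. **Biased elementary doctrine.** A biased primary doctrine with, for every object $X$ and every weak product $X\xleftarrow{\mathsf{p}_1}W\xrightarrow{\mathsf{p}_2}X$, a (fixed) element $\delta^{(\mathsf{p}_1,\mathsf{p}_2)}\in\mathsf{P}(W)$ such that: 1. for every $d:X\to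 W$ with $\mathsf{p}_1d=\mathsf{p}_2d=1_X$, $\top_X\le\mathsf{P}_d\delta^{(\mathsf{p}_1,\mathsf{p}_2)}$; 2. for every $\alpha\in\mathsf{P}(X)$, $\mathsf{P}_{\mathsf{p}_1}\alpha\wedge\delta^{(\mathsf{p}_1,\mathsf{p}_2)}\le\mathsf{P}_{\mathsf{p}_2}\alpha$; 3. for every weak product $X'\xleftarrow{\mathsf{p}'_1}W'\xrightarrow{\mathsf{p}'_2}X'$ and arrows $f:X'\to X$, $g:W'\to W$ with $\mathsf{p}_ig=f\mathsf{p}'_i$ ($i=1,2$), $\delta^{(\mathsf{p}'_1,\mathsf{p}'_2)}\le\mathsf{P}_g\delta^{(\mathsf{p}_1,\mathsf{p}_2)}$; 4. for every weak product $W\xleftarrow{\mathsf{r}_1}U\xrightarrow{\mathsf{r}_2}W$ and $t,t':U\to W$ with $\mathsf{p}_1t=\mathsf{p}_1\mathsf{r}_1$, $\mathsf{p}_2t=\mathsf{p}_1\mathsf{r}_2$, $\mathsf{p}_1t'=\mathsf{p}_2\mathsf{r}_1$, $\mathsf{p}_2t'=\mathsf{p}_2\mathsf{r}_2$: $\mathsf{P}_{\mathsf{r}_1}\delta^{(\mathsf{p}_1,\mathsf{p}_2)}\wedge\mathsf{P}_t\delta^{(\mathsf{p}_1,\mathsf{p}_2)}\wedge\mathsf{P}_{t'}\delta^{(\mathsf{p}_1,\mathsf{p}_2)}\le\mathsf{P}_{\mathsf{r}_2}\delta^{(\mathsf{p}_1,\mathsf{p}_2)}$. **Proof-irrelevant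 elements.** Let $\mathsf{p}_i:W\to X_i$, $1\le i\le n$, be a weak product. An element $\alpha\in\mathsf{P}(W)$ is proof-irrelevant if for some (equivalently, every) choice of weak products $W\xleftarrow{\mathsf{r}_1}U\xrightarrow{\mathsf{r}_2}W$, $X_i\xleftarrow{\mathsf{q}^i_1}W_i\xrightarrow{\mathsf{q}^i_2}X_i$ and arrows $t_i:U\to W_i$ with $\mathsf{q}^i_jt_i=\mathsf{p}_i\mathsf{r}_j$ ($j=1,2$) one has $\mathsf{P}_{\mathsf{r}_1}\alpha\wedge\bigwedge_{i}\mathsf{P}_{t_i}\delta^{(\mathsf{q}^i_1,\mathsf{q}^i_2)}\le\mathsf{P}_{\mathsf{r}_2}\alpha$. **Product completion and strictification.** $\mathscr{C}_s$ has as objects finite lists $[X_1,\dots,X_n]$ of objects of $\mathscr{C}$; an arrow $[X_1,\dots,X_n]\to[Y_1,\dots,Y_m]$ is a pair $(f,s)$ with $s:\{1,\dots,m\}\to\{1,\dots,n\}$ a function and $f=[f_1,\dots,f_m]$, $f_j:X_{s(j)}\to Y_j$. Finite products are list concatenation; $[f]:[X]\to[Y]$ is the arrow given by $f:X\to Y$. The strictification $\mathsf{P}^{s}:\mathscr{C}_s^{\mathrm{op}}\to\mathsf{InfSL}$: for a non-empty list, $\mathsf{P}^{s}[X_1,\dots,X_n]$ is the inf-semilattice of proof-irrelevant elements of weak products of $X_1,\dots,X_n$, where those of different weak products $W,W'$ are identified via the isomorphisms $\mathsf{P}_h$ for any $h:W\to W'$ commuting with projections (independent of $h$); $\mathsf{P}^{s}([\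 ])=\{*\}$. In particular $\mathsf{P}^{s}[X]=\mathsf{P}(X)$. For an arrow $(f,s):[X_1,\dots,X_n]\to[Y_1,\dots,Y_m]$ of $\mathscr{C}_s$ (with $s:\{1,\dots,m\}\to\{1,\dots,n\}$ and $f=[f_1,\dots,f_m]$, $f_j:X_{s(j)}\to Y_j$) with $m\ge1$, $\mathsf{P}^{s}_{(f,s)}$ sends the class of $\alpha\in\mathsf{P}(V)$ ($\mathsf{p}'_j:V\to Y_j$ a weak product) to the class of $\mathsf{P}_g\alpha$, for any $g:W\to V$ with $\mathsf{p}'_jg=f_j\mathsf{p}_{s(j)}$, $\mathsf{p}_i:W\to X_i$ a weak product; $*$ is sent to the top. $\delta_{[X]}\in\mathsf{P}^{s}[X,X]$ is the class of the elements $\delta^{(\mathsf{p}_1,\mathsf{p}_2)}$. **Equivalence relations.** For a functor $Q:\mathscr{D}^{\mathrm{op}}\to\mathsf{InfSL}$ on a category with strict finite products, a $Q$-equivalence relation on $X$ is $\rho\in Q(X\times X)$ with $\top_X\le Q_{\Delta_X}\rho$, $Q_{\langle p_2,p_1\rangle}\rho\le\rho$, $Q_{\langle p_1,p_2\rangle}\rho\wedge Q_{\langle p_2,p_3\rangle}\rho\le Q_{\langle p_1,p_3\rangle}\rho$; its descent data are $\mathrm{Des}_\rho=\{\alpha\in Q(X): Q_{p_1}\alpha\wedge\rho\le Q_{p_2}\alpha\}$. For a biased elementary doctrine $\mathsf{P}$, a $\mathsf{P}$-equivalence relation on $X\in\mathscr{C}$ is a $\mathsf{P}^{s}$-equivalence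 relation $\rho\in\mathsf{P}^{s}[X,X]$ on $[X]$, and $\mathrm{Des}_\rho\subseteq\mathsf{P}^s[X]=\mathsf{P}(X)$. **Biased elementary quotient completion.** Objects of $\overline{\mathscr{C}}$ are pairs $(X,\rho)$ with $\rho$ a $\mathsf{P}$-equivalence relation on $X\in\mathscr{C}$; arrows $(X,\rho)\to(Y,\sigma)$ are equivalence classes $\lfloor f\rceil$ of arrows $f:X\to Y$ of $\mathscr{C}$ with $\rho\le\mathsf{P}^{s}_{[f]\times[f]}\sigma$, where $f\sim f'$ iff $\rho\le\mathsf{P}^{s}_{[f]\times[f']}\sigma$. $\overline{\mathsf{P}}(X,\rho)=\mathrm{Des}_\rho$ and $\overline{\mathsf{P}}_{\lfloor f\rceil}=\mathsf{P}_f$. **Elementary doctrine (strict).** A functor $R:\mathscr{D}^{\mathrm{op}}\to\mathsf{InfSL}$, $\mathscr{D}$ with strict finite products, such that for every $X$ there is $\delta_X\in R(X\times X)$ with: $\top_X\le R_{\Delta_X}\delta_X$; $R_{p_1}\alpha\wedge\delta_X\le R_{p_2}\alpha$ for all $\alpha\in R(X)$; $R_{\langle p_1,p_3\rangle}\delta_X\wedge R_{\langle p_2,p_4\rangle}\delta_Y\le\delta_{X\times Y}$ for all $X,Y$. **Quotients (in an elementary doctrine $R$).** A quotient of an $R$-equivalence relation $\rho$ on $X$ is $q:X\to C$ with $\rho\le R_{q\times q}\delta_C$ such that every $g:X\to Z$ with $\rho\le R_{g\times g}\delta_Z$ factors uniquely as $g=hq$. It is effective if $\rho=R_{q\times q}\delta_C$;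 of effective descent if $R_q:R(C)\to\mathrm{Des}_\rho$ is an isomorphism; stable if for every arrow $f:C'\to C$ and every pullback square of $q$ along $f$ the pulled back arrow $q':X'\to C'$ is a quotient of an $R$-equivalence relation. **Comprehensions.** For $\alpha\in\mathsf{P}(X)$, a comprehension of $\alpha$ is $c:C\to X$ with $\top_C\le\mathsf{P}_c\alpha$ such that every $f:Y\to X$ with $\top_Y\le\mathsf{P}_f\alpha$ factors as $f=ch$ for some $h:Y\to C$; it is strict if $h$ is always unique, weak if uniqueness is not required. It is full if $\alpha\le\beta$ whenever $\top_C\le\mathsf{P}_c\beta$. The doctrine ''has'' such comprehensions if every element of every fiber has one. **Comprehensive diagonals.** An elementary doctrine $R$ has comprehensive diagonals if for all $f,g:A\to X$: $\top_A\le R_{\langle f,g\rangle}\delta_X$ iff $f=g$. A biased elementary doctrine $\mathsf{P}$ has comprehensive diagonals if for all $f,g:A\to X$: $f=g$ iff there exist a weak product $X\xleftarrow{\mathsf{p}_1}W\xrightarrow{\mathsf{p}_2}X$ and $h:A\to W$ with $\mathsf{p}_1h=f$, $\mathsf{p}_2h=g$ and $\top_A\le\mathsf{P}_h\delta^{(\mathsf{p}_1,\mathsf{p}_2)}$. *)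

(* Defs.v *)
From HB Require Import structures.
From mathcomp Require Import all_boot all_order.
From mathcomp Require Import boolp.

Set Implicit Arguments.
Unset Strict Implicit.
Unset Printing Implicit Defensive.

Import Order.TTheory.

Local Open Scope order_scope.
Local Open Scope quotient_scope.

(* MathComp orders are boolean-valued; with the classical axioms of [boolp]
   this is no restriction on the posets considered. *)

Fact infsl_display : Order.disp_t. Proof. exact: Order.Disp tt tt. Qed.

Notation infsl := (tMeetSemilatticeType infsl_display).

Record infsl_data := InfslData {
  infsl_sort : Type;
  infsl_le : rel infsl_sort;
  infsl_le_refl : reflexive infsl_le;
  infsl_le_anti : antisymmetric infsl_le;
  infsl_le_trans : transitive infsl_le;
  infsl_meet : infsl_sort -> infsl_sort -> infsl_sort;
  infsl_lexI : forall x y z,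
    infsl_le x (infsl_meet y z) = infsl_le x y && infsl_le x z;
  infsl_top : infsl_sort;
  infsl_lex1 : forall x, infsl_le x infsl_top }.

Section InfslOf.
Variable D : infsl_data.
HB.instance Definition _ := gen_eqMixin (infsl_sort D).
HB.instance Definition _ := gen_choiceMixin (infsl_sort D).
HB.instance Definition _ := Order.Le_isPOrder.Build infsl_display
  (infsl_sort D) (@infsl_le_refl D) (@infsl_le_anti D) (@infsl_le_trans D).
HB.instance Definition _ := Order.POrder_isMeetSemilattice.Build infsl_display
  (infsl_sort D) (@infsl_lexI D).
HB.instance Definition _ := Order.hasTop.Build infsl_display (infsl_sort D)
  (@infsl_lex1 D).

Definition infsl_of : infsl := infsl_sort D.
End InfslOf.

Definition unit_infsl : infsl := infsl_of
  (@InfslData unit (fun _ _ => true) (fun _ => erefl)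
    (fun x y => match x, y with tt, tt => fun _ => erefl end)
    (fun _ _ _ _ _ => erefl) (fun _ _ => tt) (fun _ _ _ => erefl)
    tt (fun _ => erefl)).

Section SubInfsl.
Variables (L : infsl) (S : pred L).
Hypotheses (S1 : S \top) (SI : forall x y, S x -> S y -> S (x `&` y)).
Let T := {x : L | S x}.

Definition sub_infsl : infsl := infsl_of
  (@InfslData T (fun x y => val x <= val y)
    (fun x => lexx (val x)) (fun x y h => val_inj (le_anti h))
    (fun y x z => @le_trans _ _ (val y) (val x) (val z))
    (fun x y => exist _ (val x `&` val y) (SI (valP x) (valP y)))
    (fun x y z => lexI (val x) (val y) (val z))
    (exist _ \top S1) (fun x => lex1 (val x))).
End SubInfsl.

Record category := Category {
  ob :> Type;
  hom : ob -> ob -> Type;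
  idm : forall X, hom X X;
  comp : forall X Y Z, hom Y Z -> hom X Y -> hom X Z;
  comp1m : forall X Y (f : hom X Y), comp (idm Y) f = f;
  compm1 : forall X Y (f : hom X Y), comp f (idm X) = f;
  compA : forall X Y Z T (h : hom Z T) (g : hom Y Z) (f : hom X Y),
    comp h (comp g f) = comp (comp h g) f }.

Arguments hom {c} _ _.
Arguments idm {c} _.
Arguments comp {c X Y Z} _ _.

Notation "g \oc f" := (comp g f)
  (at level 40, left associativity, format "g  \oc  f").

Record finprods (D : category) := Finprods {
  pterm : D;
  pbang : forall X, hom X pterm;
  pbang_uniq : forall X (f : hom X pterm), f = pbang X;
  pprod : D -> D -> D;
  pfst : forall X Y, hom (pprod X Y) X;
  psnd : forall X Y, hom (pprod X Y) Y;
  ppair : forall Z X Y, hom Z X -> hom Z Y -> hom Z (pprod X Y);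
  pfst_pair : forall Z X Y (f : hom Z X) (g : hom Z Y),
    pfst X Y \oc ppair f g = f;
  psnd_pair : forall Z X Y (f : hom Z X) (g : hom Z Y),
    psnd X Y \oc ppair f g = g;
  ppair_uniq : forall Z X Y (h : hom Z (pprod X Y)),
    h = ppair (pfst X Y \oc h) (psnd X Y \oc h) }.

Arguments pfst {D} _ X Y.
Arguments psnd {D} _ X Y.
Arguments ppair {D} _ {Z X Y} _ _.

Definition pdiag D (F : finprods D) (X : D) := ppair F (idm X) (idm X).

Definition pmap D (F : finprods D) (X Y X' Y' : D)
    (f : hom X Y) (g : hom X' Y') : hom (pprod F X X') (pprod F Y Y') :=
  ppair F (f \oc pfst F X X') (g \oc psnd F X X').

Definition is_pullback (D : category) (T' T S' S : D)
    (q' : hom T' S') (f' : hom T' T) (q : hom T S) (f : hom S' S) : Prop :=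
  f \oc q' = q \oc f' /\
  forall Z (a : hom Z S') (b : hom Z T), f \oc a = q \oc b ->
    exists! k : hom Z T', q' \oc k = a /\ f' \oc k = b.

Record doctrine (C : category) := Doctrine {
  fib :> C -> infsl;
  reidx : forall X Y, hom X Y -> fib Y -> fib X;
  reidx1 : forall X (a : fib X), reidx (idm X) a = a;
  reidx_comp : forall X Y Z (g : hom Y Z) (f : hom X Y) (a : fib Z),
    reidx (g \oc f) a = reidx f (reidx g a);
  reidxT : forall X Y (f : hom X Y), reidx f \top = \top;
  reidxI : forall X Y (f : hom X Y) (a b : fib Y),
    reidx f (a `&` b) = reidx f a `&` reidx f b }.

Arguments reidx {C d X Y} _ _.

Notation "f \^* a" := (reidx f a)
  (at level 35, right associativity, format "f  \^*  a").

Section DoctrineTheory.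
Variables (D : category) (Q : doctrine D).

Lemma reidx_mono X Y (f : hom X Y) (a b : Q Y) :
  a <= b -> f \^* a <= f \^* b.
Proof. by rewrite !leEmeet -reidxI => /eqP->. Qed.

Lemma reidx_meets X Y (f : hom X Y) (I : finType) (a : I -> Q Y) :
  f \^* (\meet_i a i) = \meet_i f \^* a i.
Proof. by apply: big_morph; [exact: reidxI | exact: reidxT]. Qed.

End DoctrineTheory.

Section Relations.
Variables (D : category) (F : finprods D) (Q : doctrine D).

Definition is_eqrel (X : D) (r : Q (pprod F X X)) : Prop :=
  let X2 := pprod F X X in
  let p1 := pfst F X X \oc pfst F X2 X in
  let p2 := psnd F X X \oc pfst F X2 X in
  let p3 := psnd F X2 X in
  [/\ (\top : Q X) <= pdiag F X \^* r,
      ppair F (psnd F X X) (pfst F X X) \^* r <= r &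
      ppair F p1 p2 \^* r `&` ppair F p2 p3 \^* r <= ppair F p1 p3 \^* r].

Definition des (X : D) (r : Q (pprod F X X)) : pred (Q X) :=
  fun a => pfst F X X \^* a `&` r <= psnd F X X \^* a.

Lemma des_top X (r : Q (pprod F X X)) : des r \top.
Proof. by rewrite /des !reidxT lex1. Qed.

Lemma des_meet X (r : Q (pprod F X X)) a b :
  des r a -> des r b -> des r (a `&` b).
Proof.
rewrite /des !reidxI => ha hb; rewrite lexI.
by rewrite (le_trans _ ha) ?(le_trans _ hb) // leI2 // ?leIl ?leIr.
Qed.

Definition des_infsl X (r : Q (pprod F X X)) : infsl :=
  sub_infsl (des_top r) (@des_meet X r).

Lemma ppair_comp Z' Z X Y (f : hom Z X) (g : hom Z Y) (h : hom Z' Z) :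
  ppair F f g \oc h = ppair F (f \oc h) (g \oc h).
Proof. by rewrite [LHS]ppair_uniq !compA pfst_pair psnd_pair. Qed.

Lemma pmap_pair Z X Y X' Y' (f : hom X Y) (g : hom X' Y')
    (a : hom Z X) (b : hom Z X') :
  pmap F f g \oc ppair F a b = ppair F (f \oc a) (g \oc b).
Proof. by rewrite ppair_comp -!compA pfst_pair psnd_pair. Qed.

Lemma ppair_id X Y : ppair F (pfst F X Y) (psnd F X Y) = idm _.
Proof. by rewrite [RHS]ppair_uniq !compm1. Qed.

Variables (X : D) (r : Q (pprod F X X)) (er : is_eqrel r).

Lemma eqrel_refl A (a : hom A X) : (\top : Q A) <= ppair F a a \^* r.
Proof.
case: er => h _ _; rewrite -(reidxT Q a).
have -> : ppair F a a = pdiag F X \oc a by rewrite ppair_comp comp1m.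
by rewrite reidx_comp reidx_mono.
Qed.

Lemma eqrel_sym A (a b : hom A X) :
  ppair F a b \^* r <= ppair F b a \^* r.
Proof.
case: er => _ h _.
have -> : ppair F a b = ppair F (psnd F X X) (pfst F X X) \oc ppair F b a.
  by rewrite ppair_comp pfst_pair psnd_pair.
by rewrite reidx_comp reidx_mono.
Qed.

Lemma eqrel_trans A (a b c : hom A X) :
  ppair F a b \^* r `&` ppair F b c \^* r <= ppair F a c \^* r.
Proof.
case: er => _ _ /(reidx_mono (ppair F (ppair F a b) c)).
by rewrite reidxI -!reidx_comp !ppair_comp -!compA !(pfst_pair, psnd_pair).
Qed.

Lemma des_reidx (a : Q X) A (f g : hom A X) : des r a ->
  f \^* a `&` ppair F f g \^* r <= g \^* a.
Proof.
move=> /(reidx_mono (ppair F f g)).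
by rewrite reidxI -!reidx_comp pfst_pair psnd_pair.
Qed.

End Relations.

Arguments is_eqrel {D} F Q {X} r.
Arguments des {D} F Q {X} r _.
Arguments des_infsl {D} F Q {X} r.

(* Products and deltas are bundled as data: products are unique up to
   isomorphism, and the axioms determine the deltas once products are fixed. *)
Record elementary (D : category) (R : doctrine D) := Elementary {
  el_prods :> finprods D;
  el_delta : forall X, R (pprod el_prods X X);
  el_refl : forall X, (\top : R X) <= pdiag el_prods X \^* el_delta X;
  el_subst : forall X (a : R X),
    pfst el_prods X X \^* a `&` el_delta X <= psnd el_prods X X \^* a;
  el_deltaM : forall X Y,
    let XY := pprod el_prods X Y in
    let p1 := pfst el_prods X Y \oc pfst el_prods XY XY in
    let p2 := psnd el_prods X Y \oc pfst el_prods XY XY in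
    let p3 := pfst el_prods X Y \oc psnd el_prods XY XY in
    let p4 := psnd el_prods X Y \oc psnd el_prods XY XY in
    ppair el_prods p1 p3 \^* el_delta X `&` ppair el_prods p2 p4 \^* el_delta Y
      <= el_delta XY }.

Section Quotients.
Variables (D : category) (R : doctrine D) (E : elementary R).

Definition is_quotient (X : D) (r : R (pprod E X X)) (S : D) (q : hom X S) :=
  r <= pmap E q q \^* el_delta E S /\
  forall Z (g : hom X Z), r <= pmap E g g \^* el_delta E Z ->
    exists! h : hom S Z, g = h \oc q.

Definition effective (X : D) (r : R (pprod E X X)) (S : D) (q : hom X S) :=
  r = pmap E q q \^* el_delta E S.

Definition effective_descent (X : D) (r : R (pprod E X X)) (S : D)
    (q : hom X S) : Prop :=
  exists Rq : R S -> des_infsl E R r,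
  exists g : des_infsl E R r -> R S,
    [/\ forall a, sval (Rq a) = q \^* a,
        g \top = \top, {morph g : a b / a `&` b}, cancel Rq g & cancel g Rq].

Definition stable (X S : D) (q : hom X S) : Prop :=
  forall (S' X' : D) (f : hom S' S) (q' : hom X' S') (f' : hom X' X),
    is_pullback q' f' q f ->
    exists r' : R (pprod E X' X'), is_eqrel E R r' /\ is_quotient r' q'.

Definition has_effective_quotients_of_effective_descent : Prop :=
  forall (X : D) (r : R (pprod E X X)), is_eqrel E R r ->
    exists S (q : hom X S),
      [/\ is_quotient r q, effective r q & effective_descent r q].

Definition has_stable_quotients : Prop :=
  forall (X : D) (r : R (pprod E X X)) (S : D) (q : hom X S),
    is_eqrel E R r -> is_quotient r q -> stable q.

Definition comprehensive_diagonals : Prop :=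
  forall (A X : D) (f g : hom A X),
    (\top : R A) <= ppair E f g \^* el_delta E X <-> f = g.

End Quotients.

Section Comprehensions.
Variables (C : category) (P : doctrine C).

Definition weak_comprehension (X : C) (a : P X) (K : C) (c : hom K X) :=
  (\top : P K) <= c \^* a /\
  forall Y (f : hom Y X), (\top : P Y) <= f \^* a -> exists h : hom Y K, f = c \oc h.

Definition strict_comprehension (X : C) (a : P X) (K : C) (c : hom K X) :=
  (\top : P K) <= c \^* a /\
  forall Y (f : hom Y X), (\top : P Y) <= f \^* a -> exists! h : hom Y K, f = c \oc h.

Definition full (X : C) (a : P X) (K : C) (c : hom K X) :=
  forall b : P X, (\top : P K) <= c \^* b -> a <= b.

Definition has_weak_full_comprehensions : Prop :=
  forall (X : C) (a : P X), exists K (c : hom K X),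
    weak_comprehension a c /\ full a c.

Definition has_strict_full_comprehensions : Prop :=
  forall (X : C) (a : P X), exists K (c : hom K X),
    strict_comprehension a c /\ full a c.

End Comprehensions.

(* [idx l] is the set of positions of [l] and [lnth i] the entry at position
   [i].  Unlike ['I_(size l)] they compute on concrete lists: the positions of
   [[:: X; Y]] are [None] and [Some None], with entries convertible to [X] and
   [Y]. *)

Fixpoint idx (T : Type) (l : seq T) : finType :=
  if l is _ :: l' then option (idx l') else void.

Fixpoint lnth (T : Type) (l : seq T) : idx l -> T :=
  match l with
  | [::] => fun i : void => match i with end
  | x :: l' => fun i : option (idx l') => if i is Some j then lnth j else x
  end.

Section WeakProducts.
Variable C : category.

Definition weak_product (l : seq C) (W : C)
    (p : forall i : idx l, hom W (lnth i)) : Prop :=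
  forall Z (f : forall i : idx l, hom Z (lnth i)),
    exists h : hom Z W, forall i, p i \oc h = f i.

Definition weak_product2 (X Y W : C) (p1 : hom W X) (p2 : hom W Y) : Prop :=
  forall Z (f1 : hom Z X) (f2 : hom Z Y),
    exists h : hom Z W, p1 \oc h = f1 /\ p2 \oc h = f2.

Definition has_weak_products : Prop :=
  forall l : seq C, exists W (p : forall i : idx l, hom W (lnth i)),
    weak_product p.

Record wprod (l : seq C) := Wprod {
  wapex :> C;
  wproj : forall i : idx l, hom wapex (lnth i);
  wprodP : weak_product wproj }.

Definition cone1 (X : C) : forall i : idx [:: X], hom X (lnth i) :=
  fun i => match i return hom X (lnth (l := [:: X]) i) with
           | None => idm X
           | Some v => match v with end
           end.

Lemma cone1P X : weak_product (@cone1 X).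
Proof. by move=> Z f; exists (f None) => -[[]|] /=; rewrite comp1m. Qed.

Definition wprod1 X := Wprod (@cone1P X).

End WeakProducts.

Arguments weak_product {C l W} p.
Arguments weak_product2 {C X Y W} p1 p2.

Record biased_primary (C : category) := BiasedPrimary {
  bp_doctrine :> doctrine C;
  bp_wprods : has_weak_products C }.

Record biased_elementary (C : category) := BiasedElementary {
  be_primary :> biased_primary C;
  delta : forall (X W : C) (p1 p2 : hom W X),
    weak_product2 p1 p2 -> be_primary W;
  delta_refl : forall (X W : C) (p1 p2 : hom W X) (w : weak_product2 p1 p2)
      (d : hom X W),
    p1 \oc d = idm X -> p2 \oc d = idm X -> (\top : be_primary X) <= d \^* delta w;
  delta_subst : forall (X W : C) (p1 p2 : hom W X) (w : weak_product2 p1 p2)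
      (a : be_primary X),
    p1 \^* a `&` delta w <= p2 \^* a;
  delta_mor : forall (X W : C) (p1 p2 : hom W X) (w : weak_product2 p1 p2)
      (X' W' : C) (p1' p2' : hom W' X') (w' : weak_product2 p1' p2')
      (f : hom X' X) (g : hom W' W),
    p1 \oc g = f \oc p1' -> p2 \oc g = f \oc p2' ->
    delta w' <= g \^* delta w;
  delta_irr : forall (X W : C) (p1 p2 : hom W X) (w : weak_product2 p1 p2)
      (U : C) (r1 r2 : hom U W) (_ : weak_product2 r1 r2) (t t' : hom U W),
    p1 \oc t = p1 \oc r1 -> p2 \oc t = p1 \oc r2 ->
    p1 \oc t' = p2 \oc r1 -> p2 \oc t' = p2 \oc r2 ->
    r1 \^* delta w `&` t \^* delta w `&` t' \^* delta w <= r2 \^* delta w }.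

Arguments delta {C} b {X W p1 p2} _.
Arguments delta_refl {C} b {X W p1 p2} w {d} _ _.
Arguments delta_subst {C} b {X W p1 p2} w a.
Arguments delta_mor {C} b {X W p1 p2} w {X' W' p1' p2'} w' {f g} _ _.
Arguments delta_irr {C} b {X W p1 p2} w {U r1 r2} _ {t t'} _ _ _ _.

Definition biased_comprehensive_diagonals (C : category)
    (P : biased_elementary C) : Prop :=
  forall (A X : C) (f g : hom A X), f = g <->
    exists (W : C) (p1 p2 : hom W X) (w : weak_product2 p1 p2) (h : hom A W),
      [/\ p1 \oc h = f, p2 \oc h = g & (\top : P A) <= h \^* delta P w].

Definition proof_irrelevant (C : category) (P : biased_elementary C)
    (l : seq C) (w : wprod l) (a : P w) : Prop :=
  exists (U : C) (r1 r2 : hom U w) (_ : weak_product2 r1 r2)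
    (V : idx l -> C) (q1 q2 : forall i, hom (V i) (lnth i))
    (v : forall i, weak_product2 (q1 i) (q2 i)) (t : forall i, hom U (V i)),
    [/\ forall i, q1 i \oc t i = wproj w i \oc r1,
        forall i, q2 i \oc t i = wproj w i \oc r2 &
        r1 \^* a `&` \meet_i t i \^* delta P (v i) <= r2 \^* a].

Section ProofIrrelevance.
Variables (C : category) (P : biased_elementary C).

Lemma weak_product2_ex (X Y : C) :
  exists (W : C) (p1 : hom W X) (p2 : hom W Y), weak_product2 p1 p2.
Proof.
have [W [p wp]] := bp_wprods P [:: X; Y].
exists W, (p None), (p (Some None)) => Z f1 f2.
pose f (i : idx [:: X; Y]) : hom Z (lnth i) :=
  match i return hom Z (lnth (l := [:: X; Y]) i) with
  | None => f1
  | Some j => match j return hom Z (lnth (l := [:: X; Y]) (Some j)) with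
              | None => f2
              | Some v => match v with end
              end
  end.
by have [h hh] := wp Z f; exists h; split; [exact: hh None | exact: hh (Some None)].
Qed.

(* For [x = p1 e = p2 e], [delta_irr] is used at [u = k d] where [d] is a diagonal
   of [Z] and [k : Z' -> U] has components [a z1] and [e z2]: then [t u] and
   [t' u] factor through [d], so [delta_refl] and [delta_mor] apply. *)
Lemma delta_point X W (p1 p2 : hom W X) (w : weak_product2 p1 p2)
    Z (e : hom Z W) : p1 \oc e = p2 \oc e -> (\top : P Z) <= e \^* delta P w.
Proof.
move=> e12; set x := p1 \oc e.
have [Z' [z1 [z2 wz]]] := weak_product2_ex Z Z.
have [d [d1 d2]] := wz Z (idm Z) (idm Z).
have good (g : hom Z' W) : p1 \oc g = x \oc z1 -> p2 \oc g = x \oc z2 ->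
    (\top : P Z) <= (g \oc d) \^* delta P w.
  move=> g1 g2; rewrite reidx_comp.
  apply: (le_trans _ (reidx_mono d (delta_mor P w wz g1 g2))).
  exact: delta_refl.
have [g [g1 g2]] := w Z' (x \oc z1) (x \oc z2).
pose a := g \oc d.
have a1 : p1 \oc a = x by rewrite compA g1 -compA d1 compm1.
have a2 : p2 \oc a = x by rewrite compA g2 -compA d2 compm1.
have [U [r1 [r2 wr]]] := weak_product2_ex W W.
have [k [k1 k2]] := wr Z' (a \oc z1) (e \oc z2).
have [t [t1 t2]] := w U (p1 \oc r1) (p1 \oc r2).
have [t' [t1' t2']] := w U (p2 \oc r1) (p2 \oc r2).
have := reidx_mono (k \oc d) (delta_irr P w wr t1 t2 t1' t2').
rewrite !reidxI -!reidx_comp.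
have -> : r1 \oc (k \oc d) = a by rewrite compA k1 -compA d1 compm1.
have -> : r2 \oc (k \oc d) = e by rewrite compA k2 -compA d2 compm1.
rewrite !compA; apply: le_trans; rewrite !lexI good //= good /= ?good //.
- by rewrite compA t1' -compA k1 compA a2.
- by rewrite compA t2' -compA k2 compA -e12.
- by rewrite compA t1 -compA k1 compA a1.
- by rewrite compA t2 -compA k2 compA.
Qed.

Lemma delta_lift X W (p1 p2 : hom W X) (w : weak_product2 p1 p2)
    Z (a b : hom Z W) : p1 \oc a = p1 \oc b -> p2 \oc a = p2 \oc b ->
  a \^* delta P w <= b \^* delta P w.
Proof.
move=> ab1 ab2.
have [U [r1 [r2 wr]]] := weak_product2_ex W W.
have [u [u1 u2]] := wr Z a b.
have [t [t1 t2]] := w U (p1 \oc r1) (p1 \oc r2).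
have [t' [t1' t2']] := w U (p2 \oc r1) (p2 \oc r2).
have := reidx_mono u (delta_irr P w wr t1 t2 t1' t2').
rewrite !reidxI -!reidx_comp u1 u2; apply: le_trans.
have tu : p1 \oc (t \oc u) = p2 \oc (t \oc u).
  by rewrite !compA t1 t2 -!compA u1 u2.
have tu' : p1 \oc (t' \oc u) = p2 \oc (t' \oc u).
  by rewrite !compA t1' t2' -!compA u1 u2.
rewrite !lexI lexx (le_trans (lex1 _) (delta_point w tu)).
by rewrite (le_trans (lex1 _) (delta_point w tu')).
Qed.

Lemma delta_indep X W (p1 p2 : hom W X) (w : weak_product2 p1 p2)
    W' (p1' p2' : hom W' X) (w' : weak_product2 p1' p2')
    Z (a : hom Z W) (b : hom Z W') :
  p1 \oc a = p1' \oc b -> p2 \oc a = p2' \oc b ->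
  a \^* delta P w = b \^* delta P w'.
Proof.
suff H V (s1 s2 : hom V X) (v : weak_product2 s1 s2)
    V' (s1' s2' : hom V' X) (v' : weak_product2 s1' s2')
    (c : hom Z V) (d : hom Z V') : s1 \oc c = s1' \oc d -> s2 \oc c = s2' \oc d ->
    c \^* delta P v <= d \^* delta P v'.
  by move=> e1 e2; apply: le_anti; rewrite !H.
move=> e1 e2; have [k [k1 k2]] := v' V s1 s2.
have := @delta_mor _ P _ _ _ _ v' _ _ _ _ v (idm X) k.
rewrite !comp1m => /(_ k1 k2) /(reidx_mono c) /le_trans; apply.
by rewrite -reidx_comp delta_lift // compA ?k1 ?k2.
Qed.

(* The reindexing of any delta on [X] along any arrow with components [x] and
   [y]; by [eqpE] it depends on nothing else. *)
Definition eqp Z X (x y : hom Z X) : P Z :=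
  let: exist W hW := cid (weak_product2_ex X X) in
  let: exist p1 hp1 := cid hW in
  let: exist p2 w := cid hp1 in
  sval (cid (w Z x y)) \^* delta P w.

Lemma eqpE X W (p1 p2 : hom W X) (w : weak_product2 p1 p2) Z (a : hom Z W) :
  a \^* delta P w = eqp (p1 \oc a) (p2 \oc a).
Proof.
rewrite /eqp; case: cid => W' hW; case: cid => q1 hq; case: cid => q2 w'.
by case: cid => h /= [h1 h2]; apply: delta_indep.
Qed.

Lemma eqpP Z X (x y : hom Z X) :
  exists W (p1 p2 : hom W X) (w : weak_product2 p1 p2) (h : hom Z W),
    [/\ p1 \oc h = x, p2 \oc h = y & eqp x y = h \^* delta P w].
Proof.
have [W [p1 [p2 w]]] := weak_product2_ex X X.
have [h [h1 h2]] := w Z x y.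
by exists W, p1, p2, w, h; split => //; rewrite eqpE h1 h2.
Qed.

Lemma eqp_reidx Z' Z X (x y : hom Z X) (k : hom Z' Z) :
  k \^* eqp x y = eqp (x \oc k) (y \oc k).
Proof.
have [W [p1 [p2 [w [h [h1 h2 ->]]]]]] := eqpP x y.
by rewrite -reidx_comp eqpE !compA h1 h2.
Qed.

Lemma eqp_refl Z X (x : hom Z X) : (\top : P Z) <= eqp x x.
Proof.
have [W [p1 [p2 [w [h [h1 h2 ->]]]]]] := eqpP x x.
by apply: delta_point; rewrite h1.
Qed.

Lemma eqp_mor Z X Y (x y : hom Z X) (f : hom X Y) :
  eqp x y <= eqp (f \oc x) (f \oc y).
Proof.
have [W [p1 [p2 [w [h [h1 h2 ->]]]]]] := eqpP x y.
have [V [q1 [q2 v]]] := weak_product2_ex Y Y.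
have [g [g1 g2]] := v W (f \oc p1) (f \oc p2).
apply: le_trans (reidx_mono h (delta_mor P v w g1 g2)) _.
by rewrite -reidx_comp eqpE !compA g1 g2 -!compA h1 h2.
Qed.

Lemma eqp_subst Z X (x y : hom Z X) (a : P X) :
  x \^* a `&` eqp x y <= y \^* a.
Proof.
have [W [p1 [p2 [w [h [h1 h2 ->]]]]]] := eqpP x y.
have /(reidx_mono h) := delta_subst P w a.
by rewrite reidxI -!reidx_comp h1 h2.
Qed.

(* Independence of the choices made in [proof_irrelevant]. *)
Lemma proof_irrelevantP (l : seq C) (w : wprod l) (a : P w) :
  proof_irrelevant a <->
  forall Z (h1 h2 : hom Z w),
    h1 \^* a `&` \meet_i eqp (wproj w i \oc h1) (wproj w i \oc h2)
      <= h2 \^* a.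
Proof.
split=> [[U [r1 [r2 [wr [V [q1 [q2 [v [t [t1 t2 le_a]]]]]]]]]] Z h1 h2|H].
  have [u [u1 u2]] := wr Z h1 h2.
  have := reidx_mono u le_a; rewrite reidxI reidx_meets -!reidx_comp u1 u2.
  apply: le_trans; apply: leI2 => //; apply/meetsP => i _.
  apply: (@meets_max _ _ _ i) => //.
  by rewrite -reidx_comp eqpE !compA t1 t2 -!compA u1 u2.
have [U [r1 [r2 wr]]] := weak_product2_ex w w.
have [V [q1 [q2 [v [t [t1 t2]]]]]] : exists (V : idx l -> C)
    (q1 q2 : forall i, hom (V i) (lnth i))
    (v : forall i, weak_product2 (q1 i) (q2 i)) (t : forall i, hom U (V i)),
    (forall i, q1 i \oc t i = wproj w i \oc r1) /\
    (forall i, q2 i \oc t i = wproj w i \oc r2).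
  pose V i := cid (weak_product2_ex (lnth (l := l) i) (lnth i)).
  pose q1 i := cid (svalP (V i)); pose q2 i := cid (svalP (q1 i)).
  pose t i := cid (svalP (q2 i) U (wproj w i \oc r1) (wproj w i \oc r2)).
  exists (fun i => sval (V i)), (fun i => sval (q1 i)), (fun i => sval (q2 i)).
  exists (fun i => svalP (q2 i)), (fun i => sval (t i)).
  by split=> i; have [] := svalP (t i).
exists U, r1, r2, wr, V, q1, q2, v, t; split=> //.
apply: (le_trans _ (H U r1 r2)); apply: leI2 => //; apply/meetsP => i _.
by apply: (@meets_max _ _ _ i) => //; rewrite eqpE t1 t2.
Qed.

Lemma proof_irrelevant_eq (l : seq C) (w : wprod l) (a : P w)
    Z (h1 h2 : hom Z w) : proof_irrelevant a ->
  (forall i, wproj w i \oc h1 = wproj w i \oc h2) -> h1 \^* a = h2 \^* a.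
Proof.
suff H (g1 g2 : hom Z w) : proof_irrelevant a ->
    (forall i, wproj w i \oc g1 = wproj w i \oc g2) -> g1 \^* a <= g2 \^* a.
  by move=> pa e; apply: le_anti; rewrite !H.
move=> /proof_irrelevantP pa e; apply: (le_trans _ (pa _ g1 g2)).
rewrite lexI lexx /=; apply/meetsP => i _.
by rewrite e (le_trans (lex1 _)) // eqp_refl.
Qed.

Lemma proof_irrelevant_top (l : seq C) (w : wprod l) :
  proof_irrelevant (\top : P w).
Proof. by apply/proof_irrelevantP => Z h1 h2; rewrite !reidxT lex1. Qed.

Lemma proof_irrelevant_meet (l : seq C) (w : wprod l) (a b : P w) :
  proof_irrelevant a -> proof_irrelevant b -> proof_irrelevant (a `&` b).
Proof.
move=> /proof_irrelevantP pa /proof_irrelevantP pb.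
apply/proof_irrelevantP => Z h1 h2; rewrite !reidxI lexI.
by rewrite (le_trans _ (pa _ h1 h2)) ?(le_trans _ (pb _ h1 h2)) //
  leI2 // ?leIl ?leIr.
Qed.

Lemma proof_irrelevant1 (X : C) (a : P X) :
  proof_irrelevant (w := wprod1 X) a.
Proof.
apply/proof_irrelevantP => Z h1 h2.
apply: (le_trans _ (eqp_subst h1 h2 a)); apply: leI2 => //.
by apply: (@meets_max _ _ _ None) => //=; rewrite !comp1m.
Qed.

Lemma proof_irrelevant_reidx (l m : seq C) (w : wprod l) (v : wprod m)
    (s : idx m -> idx l) (f : forall j, hom (lnth (s j)) (lnth j))
    (g : hom w v) (a : P v) :
  (forall j, wproj v j \oc g = f j \oc wproj w (s j)) ->
  proof_irrelevant a -> proof_irrelevant (g \^* a).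
Proof.
move=> hg /proof_irrelevantP pa; apply/proof_irrelevantP => Z h1 h2.
rewrite -!reidx_comp; apply: (le_trans _ (pa _ _ _)); apply: leI2 => //.
apply/meetsP => j _; apply: (@meets_max _ _ _ (s j)) => //.
by rewrite !compA hg -!compA eqp_mor.
Qed.

End ProofIrrelevance.

(* An arrow [(f, s)] of the product completion is encoded as the single
   function [j |-> (s j, f_j)], where [f_j : l_(s j) -> m_j]. *)

Section ProductCompletion.
Variable C : category.

Definition pc_hom (l m : seq C) : Type :=
  forall j : idx m, {i : idx l & hom (lnth i) (lnth j)}.

Definition pc_id (l : seq C) : pc_hom l l := fun i => existT _ i (idm (lnth i)).

Definition pc_comp (l m n : seq C) (g : pc_hom m n) (f : pc_hom l m) :
    pc_hom l n :=
  fun k => let j := projT1 (g k) in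
    existT _ (projT1 (f j)) (projT2 (g k) \oc projT2 (f j)).

Lemma pc_comp1m l m (f : pc_hom l m) : pc_comp (@pc_id m) f = f.
Proof.
apply: functional_extensionality_dep => j.
by rewrite /pc_comp /= comp1m; case: (f j).
Qed.

Lemma pc_compm1 l m (f : pc_hom l m) : pc_comp f (@pc_id l) = f.
Proof.
apply: functional_extensionality_dep => j.
by rewrite /pc_comp /= compm1; case: (f j).
Qed.

Lemma pc_compA k l m n (h : pc_hom m n) (g : pc_hom l m) (f : pc_hom k l) :
  pc_comp h (pc_comp g f) = pc_comp (pc_comp h g) f.
Proof.
by apply: functional_extensionality_dep => j; rewrite /pc_comp /= compA.
Qed.

Definition prod_completion : category :=
  Category pc_comp1m pc_compm1 pc_compA.

Definition pc_bang (l : seq C) : pc_hom l [::] := fun i => of_void _ i.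

Lemma pc_bang_uniq (l : seq C) (f : pc_hom l [::]) : f = @pc_bang l.
Proof. by apply: functional_extensionality_dep; case. Qed.

Fixpoint pc_fst (l m : seq C) : pc_hom (l ++ m) l :=
  match l return pc_hom (l ++ m) l with
  | [::] => @pc_bang m
  | X :: l' => fun i : idx (X :: l') =>
    match i return {k : idx (X :: l' ++ m) & hom (lnth k) (lnth (l := X :: l') i)} with
    | None => existT (fun k : idx (X :: l' ++ m) => hom (lnth k) X)
                None (idm X)
    | Some i' => existT (fun k : idx (X :: l' ++ m) => hom (lnth k) (lnth i'))
                (Some (projT1 (@pc_fst l' m i'))) (projT2 (@pc_fst l' m i'))
    end
  end.

Fixpoint pc_snd (l m : seq C) : pc_hom (l ++ m) m :=
  match l return pc_hom (l ++ m) m with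
  | [::] => @pc_id m
  | X :: l' => fun j =>
      existT (fun k : idx (X :: l' ++ m) => hom (lnth k) (lnth j))
        (Some (projT1 (@pc_snd l' m j))) (projT2 (@pc_snd l' m j))
  end.

Fixpoint pc_pair (k l m : seq C) : pc_hom k l -> pc_hom k m ->
    pc_hom k (l ++ m) :=
  match l return pc_hom k l -> pc_hom k m -> pc_hom k (l ++ m) with
  | [::] => fun _ g => g
  | X :: l' => fun f g (i : idx (X :: l' ++ m)) =>
    match i return {h : idx k & hom (lnth h) (lnth (l := X :: l' ++ m) i)} with
    | None => f None
    | Some i' => @pc_pair k l' m (fun j => f (Some j)) g i'
    end
  end.

Lemma pc_fst_pair (k l m : seq C) (f : pc_hom k l) (g : pc_hom k m) :
  pc_comp (@pc_fst l m) (pc_pair f g) = f.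
Proof.
apply: functional_extensionality_dep.
elim: l f => [|X l IH] f //= [i|]; last by rewrite /pc_comp /= comp1m; case: (f None).
exact: IH (fun j => f (Some j)) i.
Qed.

Lemma pc_snd_pair (k l m : seq C) (f : pc_hom k l) (g : pc_hom k m) :
  pc_comp (@pc_snd l m) (pc_pair f g) = g.
Proof.
apply: functional_extensionality_dep.
elim: l f => [|X l IH] f j /=; first by rewrite pc_comp1m.
exact: IH (fun j => f (Some j)) j.
Qed.

Lemma pc_pair_uniq (k l m : seq C) (h : pc_hom k (l ++ m)) :
  h = pc_pair (pc_comp (@pc_fst l m) h) (pc_comp (@pc_snd l m) h).
Proof.
apply: functional_extensionality_dep.
elim: l h => [|X l IH] h i /=; first by rewrite pc_comp1m.
case: i => [i|]; last by rewrite /pc_comp /= comp1m; case: (h None).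
exact: IH (fun j => h (Some j)) i.
Qed.

Definition pc_prods : finprods prod_completion :=
  @Finprods prod_completion [::] _ pc_bang_uniq _ pc_fst pc_snd (@pc_pair)
    (@pc_fst_pair) (@pc_snd_pair) pc_pair_uniq.

Definition pc_single (X Y : C) (f : hom X Y) :
    hom (c := prod_completion) [:: X] [:: Y] :=
  fun j => match j return {i : idx [:: X] & hom (lnth i) (lnth (l := [:: Y]) j)} with
           | None => existT (fun i : idx [:: X] => hom (lnth i) Y) None f
           | Some v => match v with end
           end.

End ProductCompletion.

Section Strictification.
Variables (C : category) (P : biased_elementary C).

Record pi_elt (l : seq C) := PiElt {
  pi_wp : wprod l;
  pi_val : P pi_wp;
  pi_irr : proof_irrelevant pi_val }.

HB.instance Definition _ l := gen_eqMixin (pi_elt l).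
HB.instance Definition _ l := gen_choiceMixin (pi_elt l).

Definition pi_ident (l : seq C) : rel (pi_elt l) := fun a b =>
  `[< exists h : hom (pi_wp a) (pi_wp b),
        (forall i, wproj (pi_wp b) i \oc h = wproj (pi_wp a) i) /\
        pi_val a = h \^* pi_val b >].

Lemma pi_ident_refl l : reflexive (@pi_ident l).
Proof.
by move=> a; apply/asboolP; exists (idm _); split=> [i|]; rewrite ?compm1 ?reidx1.
Qed.

Lemma pi_ident_symm l : symmetric (@pi_ident l).
Proof.
suff H a b : @pi_ident l a b -> pi_ident b a by move=> a b; apply/idP/idP; apply: H.
move=> /asboolP [h [hp ha]]; apply/asboolP.
have [k kp] := wprodP (pi_wp a) (wproj (pi_wp b)).
exists k; split=> //; rewrite ha -reidx_comp -[LHS]reidx1.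
apply: proof_irrelevant_eq (pi_irr b) _ => i.
by rewrite compm1 compA hp kp.
Qed.

Lemma pi_ident_trans l : transitive (@pi_ident l).
Proof.
move=> b a c /asboolP [h [hp ha]] /asboolP [k [kp kb]]; apply/asboolP.
exists (k \oc h); split=> [i|]; first by rewrite compA kp hp.
by rewrite reidx_comp -kb.
Qed.

Definition pi_identE (l : seq C) : equiv_rel (pi_elt l) :=
  EquivRel (@pi_ident l) (@pi_ident_refl l) (@pi_ident_symm l)
    (@pi_ident_trans l).

Definition pi_class (l : seq C) : Type := {eq_quot (pi_identE l)}.

Definition classof (l : seq C) (a : pi_elt l) : pi_class l :=
  \pi_{eq_quot (pi_identE l)} a.

Definition class_repr (l : seq C) (x : pi_class l) : pi_elt l :=
  repr (x : {eq_quot (pi_identE l)}).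

(* The representative of a class in the fibre over a given weak product. *)
Definition class_at (l : seq C) (w : wprod l) (x : pi_class l) : P w :=
  sval (cid (wprodP (pi_wp (class_repr x)) (wproj w)))
    \^* pi_val (class_repr x).

Lemma class_reprK l (x : pi_class l) : classof (class_repr x) = x.
Proof. exact: (@reprK _ {eq_quot (pi_identE l)}). Qed.

Lemma classof_eq l (a b : pi_elt l) : classof a = classof b <-> pi_ident a b.
Proof. by split=> [/eqmodP//|h]; apply/eqmodP. Qed.

Lemma class_at_of l (w : wprod l) (a : pi_elt l) (h : hom w (pi_wp a)) :
  (forall i, wproj (pi_wp a) i \oc h = wproj w i) ->
  class_at w (classof a) = h \^* pi_val a.
Proof.
move=> hp; rewrite /class_at; case: cid => k /= kp.
have /classof_eq/asboolP [g [gp ga]] := class_reprK (classof a).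
rewrite ga -reidx_comp; apply: proof_irrelevant_eq (pi_irr a) _ => i.
by rewrite compA gp kp hp.
Qed.

Lemma class_at_classof l (w : wprod l) (a : P w) (pa : proof_irrelevant a) :
  class_at w (classof (PiElt pa)) = a.
Proof.
by rewrite (@class_at_of _ _ (PiElt pa) (idm _)) ?reidx1 // => i; rewrite compm1.
Qed.

Lemma class_at_repr l (x : pi_class l) :
  class_at (pi_wp (class_repr x)) x = pi_val (class_repr x).
Proof.
have := @class_at_of l _ (class_repr x) (idm _) (fun i => compm1 _).
by rewrite class_reprK reidx1.
Qed.

Lemma class_at_comp l (w v : wprod l) (h : hom w v) (x : pi_class l) :
  (forall i, wproj v i \oc h = wproj w i) ->
  class_at w x = h \^* class_at v x.
Proof.
move=> hp; have [k kp] := wprodP (pi_wp (class_repr x)) (wproj v).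
have := class_at_of kp; rewrite class_reprK => ->; rewrite -reidx_comp.
rewrite -{1}(class_reprK x); apply: class_at_of => i.
by rewrite compA kp hp.
Qed.

Lemma class_at_irr l (w : wprod l) (x : pi_class l) :
  proof_irrelevant (class_at w x).
Proof.
rewrite /class_at; case: cid => k /= kp.
by apply: (@proof_irrelevant_reidx _ _ _ _ _ _ id (fun i => idm _)) (pi_irr _) => i;
  rewrite kp comp1m.
Qed.

Lemma class_at_inj l (w : wprod l) : injective (@class_at l w).
Proof.
move=> x y exy; rewrite -(class_reprK x) -(class_reprK y).
apply/classof_eq/asboolP.
have [h hp] := wprodP (pi_wp (class_repr y)) (wproj (pi_wp (class_repr x))).
exists h; split=> //.
have [k kp] := wprodP w (wproj (pi_wp (class_repr x))).
rewrite -class_at_repr (class_at_comp _ kp) exy -(class_at_comp _ kp).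
by rewrite -(class_at_of hp) class_reprK.
Qed.

Definition class_le (l : seq C) : rel (pi_class l) := fun x y =>
  pi_val (class_repr x) <= class_at (pi_wp (class_repr x)) y.

Lemma class_leE l (w : wprod l) (x y : pi_class l) :
  class_le x y = (class_at w x <= class_at w y).
Proof.
rewrite /class_le -class_at_repr; set v := pi_wp _.
have [h hp] := wprodP v (wproj w); have [k kp] := wprodP w (wproj v).
apply/idP/idP.
  by rewrite !(class_at_comp _ hp); apply: reidx_mono.
by rewrite !(class_at_comp _ kp); apply: reidx_mono.
Qed.

Definition class_meet (l : seq C) (x y : pi_class l) : pi_class l :=
  classof (PiElt (proof_irrelevant_meet (pi_irr (class_repr x))
                    (class_at_irr (pi_wp (class_repr x)) y))).

Lemma class_at_meet l (w : wprod l) (x y : pi_class l) :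
  class_at w (class_meet x y) = class_at w x `&` class_at w y.
Proof.
have [h hp] := wprodP (pi_wp (class_repr x)) (wproj w).
rewrite /class_meet (@class_at_of _ _ (PiElt _) h) //= reidxI -class_at_repr.
by rewrite -!class_at_comp.
Qed.

Definition some_wprod (l : seq C) : wprod l :=
  let: exist W hW := cid (bp_wprods P l) in
  let: exist p hp := cid hW in Wprod hp.

Definition class_top (l : seq C) : pi_class l :=
  classof (PiElt (proof_irrelevant_top P (some_wprod l))).

Lemma class_at_top l (w : wprod l) : class_at w (class_top l) = \top.
Proof.
have [h hp] := wprodP (some_wprod l) (wproj w).
by rewrite (class_at_of (a := PiElt _) hp) /= reidxT.
Qed.

Lemma class_le_refl l : reflexive (@class_le l).
Proof. by move=> x; rewrite (class_leE (some_wprod l)). Qed.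

Lemma class_le_anti l : antisymmetric (@class_le l).
Proof.
move=> x y; rewrite !(class_leE (some_wprod l)) => /le_anti.
exact: class_at_inj.
Qed.

Lemma class_le_trans l : transitive (@class_le l).
Proof. by move=> y x z; rewrite !(class_leE (some_wprod l)); apply: le_trans. Qed.

Lemma class_lexI l (x y z : pi_class l) :
  class_le x (class_meet y z) = class_le x y && class_le x z.
Proof. by rewrite !(class_leE (some_wprod l)) class_at_meet lexI. Qed.

Lemma class_lex1 l (x : pi_class l) : class_le x (class_top l).
Proof. by rewrite (class_leE (some_wprod l)) class_at_top lex1. Qed.

Definition class_infsl (l : seq C) : infsl :=
  infsl_of (InfslData (@class_le_refl l) (@class_le_anti l) (@class_le_trans l)
              (@class_lexI l) (@class_lex1 l)).

Definition class_reidx (l m : seq C) (f : pc_hom l m) (x : pi_class m) :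
    pi_class l :=
  let: exist g hg := cid (wprodP (pi_wp (class_repr x))
    (fun j => projT2 (f j) \oc wproj (some_wprod l) (projT1 (f j)))) in
  classof (PiElt (proof_irrelevant_reidx hg (pi_irr (class_repr x)))).

Lemma class_at_reidx l m (f : pc_hom l m) (x : pi_class m)
    (w : wprod l) (v : wprod m) (g : hom w v) :
  (forall j, wproj v j \oc g = projT2 (f j) \oc wproj w (projT1 (f j))) ->
  class_at w (class_reidx f x) = g \^* class_at v x.
Proof.
move=> gp; rewrite /class_reidx; case: cid => g0 g0p.
have [h hp] := wprodP (some_wprod l) (wproj w).
rewrite (class_at_of (a := PiElt _) hp) /= -reidx_comp /=.
have [k kp] := wprodP (pi_wp (class_repr x)) (wproj v).
have := class_at_of kp; rewrite class_reprK => ->; rewrite -reidx_comp.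
apply: proof_irrelevant_eq (pi_irr _) _ => j.
by rewrite !compA g0p kp -compA hp gp.
Qed.

(* The fibre over the empty list is trivial by definition: a weak terminal
   object may carry several proof-irrelevant elements. *)
Definition strict_fib (l : seq C) : infsl :=
  if l is [::] then unit_infsl else class_infsl l.

(* There is no arrow from the empty list to a non-empty one, so the last branch
   only matters when [m] is empty. *)
Definition strict_reidx (l m : seq C) :
    pc_hom l m -> strict_fib m -> strict_fib l :=
  match l, m return pc_hom l m -> strict_fib m -> strict_fib l with
  | X :: l', Y :: m' => fun f x => class_reidx f x
  | _, _ => fun _ _ => \top
  end.

Lemma strict_reidx1 l (x : strict_fib l) : strict_reidx (@pc_id C l) x = x.
Proof.
case: l x => [|X l] x /=; first by case: x.
apply: (@class_at_inj _ (some_wprod _)).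
rewrite (@class_at_reidx _ _ _ _ _ (some_wprod _) (idm _)) ?reidx1 // => j.
by rewrite compm1 comp1m.
Qed.

Lemma strict_reidx_comp l m n (g : pc_hom m n) (f : pc_hom l m)
    (x : strict_fib n) :
  strict_reidx (pc_comp g f) x = strict_reidx f (strict_reidx g x).
Proof.
case: n g x => [|Z n] g x.
  case: l f => [|X l] f //=.
  case: m f g => [|Y m] f g //=.
  apply: (@class_at_inj _ (some_wprod _)).
  have [h hp] := wprodP (some_wprod (Y :: m))
    (fun j => projT2 (f j) \oc wproj (some_wprod _) (projT1 (f j))).
  by rewrite (class_at_reidx _ hp) !class_at_top reidxT.
case: m f g => [|Y m] f g; first by case: (projT1 (g None)).
case: l f => [|X l] f; first by case: (projT1 (f None)).
apply: (@class_at_inj _ (some_wprod _)) => /=.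
have [h hp] := wprodP (some_wprod (Y :: m))
  (fun j => projT2 (f j) \oc wproj (some_wprod _) (projT1 (f j))).
have [k kp] := wprodP (some_wprod (Z :: n))
  (fun j => projT2 (g j) \oc wproj (some_wprod _) (projT1 (g j))).
rewrite (class_at_reidx _ hp) (class_at_reidx _ kp) -reidx_comp.
by apply: class_at_reidx => j; rewrite compA kp -compA hp /= compA.
Qed.

Lemma strict_reidxT l m (f : pc_hom l m) :
  strict_reidx f (\top : strict_fib m) = \top.
Proof.
case: l m f => [|X l] [|Y m] f //=.
apply: (@class_at_inj _ (some_wprod _)).
have [h hp] := wprodP (some_wprod (Y :: m))
  (fun j => projT2 (f j) \oc wproj (some_wprod _) (projT1 (f j))).
by rewrite (class_at_reidx _ hp) !class_at_top reidxT.
Qed.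

Lemma strict_reidxI l m (f : pc_hom l m) (x y : strict_fib m) :
  strict_reidx f (x `&` y) = strict_reidx f x `&` strict_reidx f y.
Proof.
case: l m f x y => [|X l] [|Y m] f x y //=; rewrite ?meetxx //.
apply: (@class_at_inj _ (some_wprod _)).
have [h hp] := wprodP (some_wprod (Y :: m))
  (fun j => projT2 (f j) \oc wproj (some_wprod _) (projT1 (f j))).
by rewrite class_at_meet !(class_at_reidx _ hp) class_at_meet reidxI.
Qed.

Definition strictification : doctrine (prod_completion C) :=
  @Doctrine (prod_completion C) strict_fib strict_reidx
    strict_reidx1 strict_reidx_comp strict_reidxT strict_reidxI.

(* The identification of [P X] with the fibre over [[:: X]]. *)
Definition single_elt (X : C) (a : P X) : strictification [:: X] :=
  classof (PiElt (proof_irrelevant1 a)).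

Lemma single_elt_at X (a : P X) : class_at (wprod1 X) (single_elt a) = a.
Proof. exact: class_at_classof. Qed.

Lemma single_elt_inj X : injective (@single_elt X).
Proof. by move=> a b e; rewrite -(single_elt_at a) e single_elt_at. Qed.

Lemma single_eltT X : single_elt (\top : P X) = \top.
Proof.
by apply: (@class_at_inj _ (wprod1 X)); rewrite single_elt_at class_at_top.
Qed.

Lemma single_eltI X (a b : P X) :
  single_elt (a `&` b) = single_elt a `&` single_elt b.
Proof.
apply: (@class_at_inj _ (wprod1 X)).
by rewrite class_at_meet !single_elt_at.
Qed.

Lemma single_elt_reidx X Y (f : hom X Y) (a : P Y) :
  single_elt (f \^* a) = pc_single f \^* single_elt a.
Proof.
apply: (@class_at_inj _ (wprod1 X)); rewrite single_elt_at.
have -> := @class_at_reidx [:: X] [:: Y] (pc_single f) (single_elt a)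
  (wprod1 X) (wprod1 Y) f; first by rewrite single_elt_at.
by case=> [[]|] /=; rewrite comp1m compm1.
Qed.

End Strictification.

Lemma pc_single_id (C : category) (X : C) : 
  pc_single (idm X) = idm ([:: X] : prod_completion C).
Proof. by apply: functional_extensionality_dep => -[[]|]. Qed.

Lemma pc_single_comp (C : category) (X Y Z : C) (g : hom Y Z) (f : hom X Y) :
  pc_single (g \oc f) = pc_single g \oc pc_single f.
Proof. by apply: functional_extensionality_dep => -[[]|]. Qed.

Section QuotientCompletion.
Variables (C : category) (P : biased_elementary C).

Let Ps := strictification P.
Let F := pc_prods C.
Let sq (X : C) : prod_completion C := pprod F [:: X] [:: X].

Record qc_ob := QcOb {
  qc_carrier : C;
  qc_rel : Ps (sq qc_carrier);
  qc_eqrel : is_eqrel F Ps qc_rel }.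

Definition qc_pmap (X Y : C) (f f' : hom X Y) : hom (sq X) (sq Y) :=
  pmap F (pc_single f) (pc_single f').

Record qc_prehom (X Y : qc_ob) := QcPrehom {
  qc_fun : hom (qc_carrier X) (qc_carrier Y);
  qc_funP : qc_rel X <= qc_pmap qc_fun qc_fun \^* qc_rel Y }.

HB.instance Definition _ X Y := gen_eqMixin (qc_prehom X Y).
HB.instance Definition _ X Y := gen_choiceMixin (qc_prehom X Y).

Definition qc_sim (X Y : qc_ob) : rel (qc_prehom X Y) := fun f f' =>
  qc_rel X <= qc_pmap (qc_fun f) (qc_fun f') \^* qc_rel Y.

Let rel_at (Y : qc_ob) (A : prod_completion C) (a b : hom A [:: qc_carrier Y]) : Ps A :=
  ppair F a b \^* qc_rel Y.

Lemma qc_mapP (X Y : qc_ob) (f f' : hom (qc_carrier X) (qc_carrier Y)) :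
  qc_rel X <= qc_pmap f f' \^* qc_rel Y <->
  forall (A : prod_completion C) (a b : hom A [:: qc_carrier X]),
    rel_at a b <= rel_at (pc_single f \oc a) (pc_single f' \oc b).
Proof.
split=> [h A a b|h].
  by rewrite /rel_at -pmap_pair reidx_comp; apply: reidx_mono.
by have := h _ (pfst F _ _) (psnd F _ _); rewrite /rel_at ppair_id reidx1.
Qed.

Lemma qc_sim_refl X Y : reflexive (@qc_sim X Y).
Proof. by move=> f; apply: qc_funP. Qed.

Lemma qc_sim_symm X Y : symmetric (@qc_sim X Y).
Proof.
suff H f g : @qc_sim X Y f g -> qc_sim g f by move=> f g; apply/idP/idP; apply: H.
move=> /qc_mapP h; apply/qc_mapP => A a b.
apply: le_trans (eqrel_sym (qc_eqrel X) a b) _.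
by apply: le_trans (h _ _ _) (eqrel_sym (qc_eqrel Y) _ _).
Qed.

Lemma qc_sim_trans X Y : transitive (@qc_sim X Y).
Proof.
move=> g f h /qc_mapP fg /qc_mapP gh; apply/qc_mapP => A a b.
apply: (le_trans _ (eqrel_trans (qc_eqrel Y) _ (pc_single (qc_fun g) \oc b) _)).
rewrite lexI fg /=; apply: (le_trans _ (gh A b b)).
by rewrite (le_trans (lex1 _)) // (eqrel_refl (qc_eqrel X) b).
Qed.

Definition qc_simE (X Y : qc_ob) : equiv_rel (qc_prehom X Y) :=
  EquivRel (@qc_sim X Y) (@qc_sim_refl X Y) (@qc_sim_symm X Y)
    (@qc_sim_trans X Y).

Definition qc_hom (X Y : qc_ob) : Type := {eq_quot (qc_simE X Y)}.

Definition qc_class X Y (f : qc_prehom X Y) : qc_hom X Y :=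
  \pi_{eq_quot (qc_simE X Y)} f.

Definition qc_repr X Y (f : qc_hom X Y) : qc_prehom X Y :=
  repr (f : {eq_quot (qc_simE X Y)}).

Lemma qc_reprK X Y (f : qc_hom X Y) : qc_class (qc_repr f) = f.
Proof. exact: (@reprK _ {eq_quot (qc_simE X Y)}). Qed.

Lemma qc_classP X Y (f g : qc_prehom X Y) :
  qc_class f = qc_class g <-> qc_sim f g.
Proof. by split=> [/eqmodP//|h]; apply/eqmodP. Qed.

Lemma qc_idP (X : qc_ob) :
  qc_rel X <= qc_pmap (idm (qc_carrier X)) (idm (qc_carrier X)) \^* qc_rel X.
Proof. by apply/qc_mapP => A a b; rewrite pc_single_id !comp1m. Qed.

Lemma qc_compP (X Y Z : qc_ob) (g : qc_prehom Y Z) (f : qc_prehom X Y) :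
  qc_rel X <= qc_pmap (qc_fun g \oc qc_fun f) (qc_fun g \oc qc_fun f)
    \^* qc_rel Z.
Proof.
have /qc_mapP hg := qc_funP g; have /qc_mapP hf := qc_funP f.
apply/qc_mapP => A a b; rewrite !pc_single_comp -!compA.
exact: le_trans (hf _ _ _) (hg _ _ _).
Qed.

Definition qc_id (X : qc_ob) : qc_hom X X := qc_class (QcPrehom (qc_idP X)).

Definition qc_comp (X Y Z : qc_ob) (g : qc_hom Y Z) (f : qc_hom X Y) :
    qc_hom X Z :=
  qc_class (QcPrehom (qc_compP (qc_repr g) (qc_repr f))).

Lemma qc_comp_class X Y Z (g : qc_prehom Y Z) (f : qc_prehom X Y) :
  qc_comp (qc_class g) (qc_class f) = qc_class (QcPrehom (qc_compP g f)).
Proof.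
apply/qc_classP/qc_mapP => A a b; rewrite !pc_single_comp -!compA.
have /qc_classP/qc_mapP hf := qc_reprK (qc_class f).
have /qc_classP/qc_mapP hg := qc_reprK (qc_class g).
exact: le_trans (hf _ _ _) (hg _ _ _).
Qed.

Lemma qc_comp1m X Y (f : qc_hom X Y) : qc_comp (qc_id Y) f = f.
Proof.
rewrite -(qc_reprK f) qc_comp_class.
by apply/qc_classP; rewrite /qc_sim /= comp1m; apply: qc_funP.
Qed.

Lemma qc_compm1 X Y (f : qc_hom X Y) : qc_comp f (qc_id X) = f.
Proof.
rewrite -(qc_reprK f) qc_comp_class.
by apply/qc_classP; rewrite /qc_sim /= compm1; apply: qc_funP.
Qed.

Lemma qc_compA X Y Z T (h : qc_hom Z T) (g : qc_hom Y Z) (f : qc_hom X Y) :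
  qc_comp h (qc_comp g f) = qc_comp (qc_comp h g) f.
Proof.
rewrite -(qc_reprK f) -(qc_reprK g) -(qc_reprK h) !qc_comp_class.
apply/qc_classP; rewrite /qc_sim /= compA.
exact: (qc_compP (QcPrehom (qc_compP (qc_repr h) (qc_repr g)))).
Qed.

Definition quotient_completion : category :=
  Category qc_comp1m qc_compm1 qc_compA.

Definition qc_des (X : qc_ob) : pred (P (qc_carrier X)) :=
  fun a => des F Ps (qc_rel X) (single_elt a).

Lemma qc_des_top X : qc_des (\top : P (qc_carrier X)).
Proof. by rewrite /qc_des single_eltT des_top. Qed.

Lemma qc_des_meet X (a b : P (qc_carrier X)) :
  qc_des a -> qc_des b -> qc_des (a `&` b).
Proof. by rewrite /qc_des single_eltI; apply: des_meet. Qed.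

Definition qc_fib (X : qc_ob) : infsl :=
  sub_infsl (qc_des_top X) (@qc_des_meet X).

Lemma qc_des_reidx X Y (f : qc_prehom X Y) (a : P (qc_carrier Y)) :
  qc_des a -> qc_des (qc_fun f \^* a).
Proof.
move=> da; rewrite /qc_des /des single_elt_reidx -!reidx_comp.
apply: (le_trans _ (des_reidx _ _ da)); apply: leI2 => //.
exact: qc_funP.
Qed.

Definition qc_reidx X Y (f : qc_hom X Y) (a : qc_fib Y) : qc_fib X :=
  exist _ (qc_fun (qc_repr f) \^* sval a)
    (qc_des_reidx (qc_repr f) (svalP a)).

Lemma qc_reidx_class X Y (f : qc_prehom X Y) (a : qc_fib Y) :
  sval (qc_reidx (qc_class f) a) = qc_fun f \^* sval a.
Proof.
suff H (g h : qc_prehom X Y) : qc_sim g h ->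
    qc_fun g \^* sval a <= qc_fun h \^* sval a.
  have e : qc_sim (qc_repr (qc_class f)) f by apply/qc_classP/qc_reprK.
  by apply: le_anti; rewrite !H // qc_sim_symm.
move=> /qc_mapP gh; suff e : single_elt (qc_fun g \^* sval a)
    <= single_elt (qc_fun h \^* sval a).
  apply/meet_idPl; apply: single_elt_inj.
  by rewrite single_eltI; apply/meet_idPl.
rewrite !single_elt_reidx.
apply: (le_trans _ (des_reidx (pc_single (qc_fun g)) _ (svalP a))).
rewrite lexI lexx /= (le_trans (lex1 _)) //.
have := gh _ (idm _) (idm _); rewrite !compm1; apply: le_trans.
exact: (eqrel_refl (qc_eqrel X)).
Qed.

Lemma qc_fib_inj X (a b : qc_fib X) : sval a = sval b -> a = b.
Proof. exact: val_inj. Qed.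

Lemma qc_reidx1 X (a : qc_fib X) : qc_reidx (qc_id X) a = a.
Proof. by apply: qc_fib_inj; rewrite qc_reidx_class /= reidx1. Qed.

Lemma qc_reidx_comp X Y Z (g : qc_hom Y Z) (f : qc_hom X Y) (a : qc_fib Z) :
  qc_reidx (qc_comp g f) a = qc_reidx f (qc_reidx g a).
Proof. by apply: qc_fib_inj; rewrite qc_reidx_class /= reidx_comp. Qed.

Lemma qc_reidxT X Y (f : qc_hom X Y) : qc_reidx f \top = \top.
Proof. by apply: qc_fib_inj; rewrite /= reidxT. Qed.

Lemma qc_reidxI X Y (f : qc_hom X Y) (a b : qc_fib Y) :
  qc_reidx f (a `&` b) = qc_reidx f a `&` qc_reidx f b.
Proof. by apply: qc_fib_inj; rewrite /= reidxI. Qed.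

Definition quotient_doctrine : doctrine quotient_completion :=
  @Doctrine quotient_completion qc_fib qc_reidx
    qc_reidx1 qc_reidx_comp qc_reidxT qc_reidxI.

End QuotientCompletion.

(* Main.v *)
(* An element of the fibre over [[:: X; X]] is a family of elements of [P Z]
   indexed by pairs of generalized points [Z -> X]: natural, and compatible with
   the equality [eqp] of points.  An equivalence relation is then such a family
   that is symmetric, transitive and contains [eqp], so that quotients,
   restrictions along arrows, and products can be defined pointwise and all
   axioms checked on points.  In the completion itself, points become arrows out
   of the discrete objects [(Z, eqp)].  The quotient of [R] on [(X, r)] is the
   identity of [X] regarded as an arrow [(X, r) -> (X, R)]; hence every quotient
   has a section in [C] up to the equivalence of its codomain, a property which
   characterizes quotients and is inherited by pullbacks. *)

Require Import Defs.
From mathcomp Require Import all_boot all_order.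
From mathcomp Require Import boolp.

Set Implicit Arguments.
Unset Strict Implicit.
Unset Printing Implicit Defensive.

Import Order.TTheory Defs.

Local Open Scope order_scope.

(** * Binary weak products with chosen pairings *)

Section BinaryProducts.
Variable C : category.

Definition cone2 (Z X Y : C) (f : hom Z X) (g : hom Z Y) :
    forall i : idx [:: X; Y], hom Z (lnth i) :=
  fun i => match i return hom Z (lnth (l := [:: X; Y]) i) with
  | None => f
  | Some j => match j return hom Z (lnth (l := [:: X; Y]) (Some j)) with
              | None => g
              | Some v => match v with end
              end
  end.

(** A choice among possibly many pairings: only its two components are determined. *)
Definition wpair (X Y : C) (w : wprod [:: X; Y]) Z (f : hom Z X) (g : hom Z Y) :
    hom Z w := sval (cid (wprodP w (cone2 f g))).

Definition wfst (X Y : C) (w : wprod [:: X; Y]) : hom w X := wproj w None.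
Definition wsnd (X Y : C) (w : wprod [:: X; Y]) : hom w Y := wproj w (Some None).

Lemma wfst_pair (X Y : C) (w : wprod [:: X; Y]) Z (f : hom Z X) (g : hom Z Y) :
  wfst w \oc wpair w f g = f.
Proof. exact: (svalP (cid (wprodP w (cone2 f g))) None). Qed.

Lemma wsnd_pair (X Y : C) (w : wprod [:: X; Y]) Z (f : hom Z X) (g : hom Z Y) :
  wsnd w \oc wpair w f g = g.
Proof. exact: (svalP (cid (wprodP w (cone2 f g))) (Some None)). Qed.

End BinaryProducts.

(** * Equality of generalized points *)

Section EqualityOfPoints.
Variables (C : category) (P : biased_elementary C).

(** This is [delta_irr] reindexed along an arrow [u] with components [h] and [h']: there [t] and
    [t'] become the pairs [x, x'] and [y, y']. Symmetry and transitivity of [eqp] follow by letting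
    some of the four points coincide. *)
Lemma eqp_irr (Z X : C) (x y x' y' : hom Z X) :
  eqp P x y `&` eqp P x x' `&` eqp P y y' <= eqp P x' y'.
Proof.
have [W [p1 [p2 w]]] := weak_product2_ex P X X.
have [U [r1 [r2 wr]]] := weak_product2_ex P W W.
have [t [t1 t2]] := w U (p1 \oc r1) (p1 \oc r2).
have [t' [t1' t2']] := w U (p2 \oc r1) (p2 \oc r2).
have [h [h1 h2]] := w Z x y; have [h' [h1' h2']] := w Z x' y'.
have [u [u1 u2]] := wr Z h h'.
have := reidx_mono u (delta_irr P w wr t1 t2 t1' t2').
rewrite !reidxI -!reidx_comp !eqpE !compA t1 t2 t1' t2' -!compA u1 u2.
by rewrite h1 h2 h1' h2'.
Qed.

Lemma eqp_sym (Z X : C) (x y : hom Z X) : eqp P x y <= eqp P y x.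
Proof.
apply: le_trans (eqp_irr x x y x).
by rewrite !lexI lexx !(le_trans (lex1 _) (eqp_refl P _)).
Qed.

Lemma eqp_trans (Z X : C) (x y z : hom Z X) :
  eqp P x y `&` eqp P y z <= eqp P x z.
Proof.
apply: le_trans (eqp_irr x y x z).
by rewrite !lexI leIl leIr (le_trans (lex1 _) (eqp_refl P _)).
Qed.

End EqualityOfPoints.

(** * Elements over [[:: X; X]] as families on pairs of points *)

Section Points.
Variables (C : category) (P : biased_elementary C).

Let Ps := strictification P.
Let F := pc_prods C.

(** The list is a cons so that [strict_fib] unfolds to classes; over [[::]] the fibre is the trivial
    one. *)
Lemma strict_leE (Y : C) (l : seq C) (w : wprod (Y :: l)) (a b : Ps (Y :: l)) :
  (a <= b) = (class_at w a <= class_at w b).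
Proof. exact: class_leE. Qed.

Lemma strict_meetE (Y : C) (l : seq C) (w : wprod (Y :: l)) (a b : Ps (Y :: l)) :
  class_at w (a `&` b) = class_at w a `&` class_at w b.
Proof. exact: class_at_meet. Qed.

Definition rel_pt (X : C) (r : Ps (pprod F [:: X] [:: X])) Z (x y : hom Z X) : P Z :=
  class_at (wprod1 Z) (ppair F (pc_single x) (pc_single y) \^* r).

Lemma rel_ptE (X : C) (r : Ps (pprod F [:: X] [:: X])) (w : wprod [:: X; X])
    Z (h : hom Z w) :
  rel_pt r (wfst w \oc h) (wsnd w \oc h) = h \^* class_at w r.
Proof.
rewrite /rel_pt.
apply: (@class_at_reidx _ P [:: Z] [:: X; X] _ r (wprod1 Z) w h).
by case=> [[[]|]|] /=; rewrite compm1.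
Qed.

(** An arrow into a singleton list has a single component, so the reindexings occurring in
    [is_eqrel], over lists of any positive length, become values of [rel_pt]. *)
Lemma class_at_pair (X : C) (r : Ps (pprod F [:: X] [:: X])) (Y : C) (l : seq C)
    (u v : hom (c := prod_completion C) (Y :: l) [:: X]) (w : wprod (Y :: l)) :
  class_at w (ppair F u v \^* r) =
  rel_pt r (projT2 (u None) \oc wproj w (projT1 (u None)))
           (projT2 (v None) \oc wproj w (projT1 (v None))).
Proof.
pose w' := some_wprod P [:: X; X].
pose h := wpair w' (projT2 (u None) \oc wproj w (projT1 (u None)))
  (projT2 (v None) \oc wproj w (projT1 (v None))).
have := rel_ptE r h; rewrite wfst_pair wsnd_pair => ->.
apply: (@class_at_reidx _ P (Y :: l) [:: X; X] _ r w w' h).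
case=> [[[]|]|] /=; [exact: wsnd_pair | exact: wfst_pair].
Qed.

Lemma rel_pt_reidx (X : C) (r : Ps (pprod F [:: X] [:: X])) Z (x y : hom Z X)
    Z' (k : hom Z' Z) :
  k \^* rel_pt r x y = rel_pt r (x \oc k) (y \oc k).
Proof.
have E := rel_ptE r (wpair (some_wprod P [:: X; X]) _ _).
have := E _ x y; rewrite wfst_pair wsnd_pair => ->.
by rewrite -reidx_comp -rel_ptE !compA wfst_pair wsnd_pair.
Qed.

(** Proof-irrelevance of [class_at w r], tested at two pairings, compares exactly their
    components. *)
Lemma rel_pt_irr (X : C) (r : Ps (pprod F [:: X] [:: X])) Z (x y x' y' : hom Z X) :
  rel_pt r x y `&` eqp P x x' `&` eqp P y y' <= rel_pt r x' y'.
Proof.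
pose w := some_wprod P [:: X; X].
have /proof_irrelevantP/(_ Z (wpair w x y) (wpair w x' y')) :=
  class_at_irr w (r : pi_class P [:: X; X]).
rewrite -!rel_ptE !wfst_pair !wsnd_pair; apply: le_trans.
rewrite -meetA; apply: leI2 => //; apply/meetsP => -[[[]|]|] _.
  by rewrite [wproj w _ \oc _]wsnd_pair [wproj w _ \oc _]wsnd_pair leIr.
by rewrite [wproj w _ \oc _]wfst_pair [wproj w _ \oc _]wfst_pair leIl.
Qed.

(** A Yoneda argument: both sides are decided at the generic pair, formed by the projections of a
    weak product, and any other pair is a reindexing of it. *)
Lemma rel_pt_le (X Y : C) (r : Ps (pprod F [:: X] [:: X]))
    (s : Ps (pprod F [:: Y] [:: Y])) (f g : hom X Y) :
  r <= qc_pmap f g \^* s <->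
  forall Z (x y : hom Z X), rel_pt r x y <= rel_pt s (f \oc x) (g \oc y).
Proof.
pose w := some_wprod P [:: X; X].
have -> : (r <= qc_pmap f g \^* s) = (rel_pt r (wfst w) (wsnd w) <=
    rel_pt s (f \oc wfst w) (g \oc wsnd w)).
  rewrite (strict_leE w) (class_at_pair s) /= !compm1; congr (_ <= _).
  by rewrite -[in RHS](compm1 (wfst w)) -[in RHS](compm1 (wsnd w)) rel_ptE reidx1.
split=> [h Z x y|]; last by apply.
have := reidx_mono (wpair w x y) h.
rewrite !rel_pt_reidx -!compA.
by rewrite wfst_pair wsnd_pair.
Qed.

End Points.

(** * Equivalence relations given by families on points *)

Section PointwiseEquivalences.
Variables (C : category) (P : biased_elementary C).

Let Ps := strictification P.
Let F := pc_prods C.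

(* Containing [eqp] subsumes both reflexivity and proof-irrelevance. *)
Record pt_eqrel (X : C) := PtEqrel {
  pe_rel :> forall Z, hom Z X -> hom Z X -> P Z;
  pe_reidx : forall Z (x y : hom Z X) Z' (k : hom Z' Z),
    k \^* pe_rel x y = pe_rel (x \oc k) (y \oc k);
  pe_eqp : forall Z (x y : hom Z X), eqp P x y <= pe_rel x y;
  pe_sym : forall Z (x y : hom Z X), pe_rel x y <= pe_rel y x;
  pe_trans : forall Z (x y z : hom Z X),
    pe_rel x y `&` pe_rel y z <= pe_rel x z }.

Variables (X : C) (e : pt_eqrel X).

Lemma pe_refl Z (x : hom Z X) : (\top : P Z) <= e Z x x.
Proof. exact: le_trans (eqp_refl P x) (pe_eqp e x x). Qed.

(** The components of [h'] are linked to each other through those of [h]; the two outer links come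
    from [eqp] and the chain closes by transitivity. *)
Lemma pe_irr : proof_irrelevant (w := some_wprod P [:: X; X])
  (e _ (wfst _) (wsnd _)).
Proof.
apply/proof_irrelevantP => Z h h'; rewrite !pe_reidx.
apply: (le_trans _ (pe_trans e _ (wfst _ \oc h) _)).
rewrite lexI; apply/andP; split.
  apply: (le_trans _ (pe_sym e _ _)); apply: (le_trans _ (pe_eqp e _ _)).
  by apply: leIxr; apply: (@meets_max _ _ _ None).
apply: (le_trans _ (pe_trans e _ (wsnd _ \oc h) _)); apply: leI2 => //.
apply: (le_trans _ (pe_eqp e _ _)).
by apply: (@meets_max _ _ _ (Some None)).
Qed.

Definition pe_class : Ps (pprod F [:: X] [:: X]) := classof (PiElt pe_irr).

Lemma pe_classE Z (x y : hom Z X) : rel_pt pe_class x y = e Z x y.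
Proof.
have := rel_ptE pe_class (wpair (some_wprod P [:: X; X]) x y).
by rewrite class_at_classof pe_reidx wfst_pair wsnd_pair.
Qed.

(** Each axiom lives over one, two or three copies of [X]; read at a weak product of these, it is
    [pe_refl], [pe_sym] or [pe_trans] at the projections. *)
Lemma pe_class_eqrel : is_eqrel F Ps pe_class.
Proof.
split.
- rewrite (strict_leE (wprod1 X)) (class_at_pair pe_class) pe_classE.
  exact: le_trans (lex1 _) (pe_refl _).
- pose w := some_wprod P [:: X; X].
  rewrite (strict_leE w) (class_at_pair pe_class) pe_classE.
  rewrite class_at_classof /= !comp1m; exact: pe_sym.
- pose w := some_wprod P [:: X; X; X].
  rewrite (strict_leE w) strict_meetE !(class_at_pair pe_class) !pe_classE; exact: pe_trans.
Qed.

Definition qc_of : qc_ob P := QcOb pe_class_eqrel.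

End PointwiseEquivalences.

(** * Objects, arrows and fibres of the completion in terms of points *)

Section PointsOfQuotientCompletion.
Variables (C : category) (P : biased_elementary C).

Let Q := quotient_doctrine P.

Section ObjectEquivalence.
Variable A : qc_ob P.

Definition eqv Z (x y : hom Z (qc_carrier A)) : P Z := rel_pt (qc_rel A) x y.

Lemma eqv_reidx Z (x y : hom Z (qc_carrier A)) Z' (k : hom Z' Z) :
  k \^* eqv x y = eqv (x \oc k) (y \oc k).
Proof. exact: rel_pt_reidx. Qed.

Lemma eqv_refl Z (x : hom Z (qc_carrier A)) : (\top : P Z) <= eqv x x.
Proof.
have := eqrel_refl (qc_eqrel A) (pc_single x).
rewrite (strict_leE (wprod1 Z)); apply: le_trans.
by rewrite [X in _ <= X]class_at_top.
Qed.

(** Reflexivity at [x], with the second point moved to [y] by proof-irrelevance. *)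
Lemma eqv_eqp Z (x y : hom Z (qc_carrier A)) : eqp P x y <= eqv x y.
Proof.
apply: le_trans (rel_pt_irr (qc_rel A) x x x y).
rewrite !lexI lexx (le_trans (lex1 _) (eqv_refl x)).
by rewrite (le_trans (lex1 _) (eqp_refl P x)).
Qed.

Lemma eqv_sym Z (x y : hom Z (qc_carrier A)) : eqv x y <= eqv y x.
Proof.
have := eqrel_sym (qc_eqrel A) (pc_single x) (pc_single y).
by rewrite (strict_leE (wprod1 Z)).
Qed.

Lemma eqv_trans Z (x y z : hom Z (qc_carrier A)) :
  eqv x y `&` eqv y z <= eqv x z.
Proof.
have := eqrel_trans (qc_eqrel A) (pc_single x) (pc_single y) (pc_single z).
by rewrite (strict_leE (wprod1 Z)) strict_meetE.
Qed.

End ObjectEquivalence.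

Lemma eqv_of X (e : pt_eqrel P X) Z (x y : hom Z X) :
  eqv (A := qc_of e) x y = e Z x y.
Proof. exact: pe_classE. Qed.

Lemma qc_fun_eqv (A B : qc_ob P) (f : qc_prehom A B) Z
    (x y : hom Z (qc_carrier A)) :
  eqv x y <= eqv (qc_fun f \oc x) (qc_fun f \oc y).
Proof. by have /rel_pt_le := qc_funP f; apply. Qed.

Section Arrows.
Variables (A B : qc_ob P) (f : hom (qc_carrier A) (qc_carrier B)).
Hypothesis fP : forall Z (x y : hom Z (qc_carrier A)),
  eqv x y <= eqv (f \oc x) (f \oc y).

Lemma qc_preP : qc_rel A <= qc_pmap f f \^* qc_rel B.
Proof. exact/rel_pt_le. Qed.

Definition qc_pre : qc_prehom A B := QcPrehom qc_preP.

End Arrows.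

(** Retypes [qc_class] as an arrow of the category, so that composition and reindexing apply to
    it. *)
Definition qc_arr (A B : quotient_completion P) (f : qc_prehom A B) : hom A B :=
  qc_class f.

Lemma qc_arr_repr (A B : quotient_completion P) (f : hom A B) :
  qc_arr (qc_repr f) = f.
Proof. exact: qc_reprK. Qed.

Lemma qc_arrP (A B : quotient_completion P) (f : hom A B) :
  exists f0, f = qc_arr f0.
Proof. by exists (qc_repr f); rewrite qc_arr_repr. Qed.

Lemma qc_arr_comp (A B D : quotient_completion P)
    (g : qc_prehom B D) (f : qc_prehom A B) :
  qc_arr g \oc qc_arr f = qc_arr (QcPrehom (qc_compP g f)).
Proof. exact: qc_comp_class. Qed.

Lemma qc_arr_id (A : quotient_completion P) :
  idm A = qc_arr (QcPrehom (qc_idP A)).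
Proof. by []. Qed.

(** The identity is the generic point of [A], so one inequality decides equality of arrows.
    Conversely [f x] is related to [f y] because [f] preserves the relations, and [f y] to [g y] by
    reindexing along [y]. *)
Lemma qc_arr_eq (A B : quotient_completion P) (f g : qc_prehom A B) :
  qc_arr f = qc_arr g <->
  (\top : P (qc_carrier A)) <= eqv (A := B) (qc_fun f) (qc_fun g).
Proof.
split=> [/qc_classP/rel_pt_le h | h].
  apply: le_trans (eqv_refl (A := A) (idm _)) _.
  by have := h _ (idm _) (idm _); rewrite !compm1.
apply/qc_classP/rel_pt_le => Z x y.
apply: le_trans (eqv_trans (A := B) _ (qc_fun f \oc y) _).
rewrite lexI; apply/andP; split; first exact: qc_fun_eqv.
apply: (le_trans (lex1 _)); rewrite -(reidxT P y).
by apply: le_trans (reidx_mono y h) _; rewrite eqv_reidx.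
Qed.

(** Descent is the same condition at the generic pair of points, from which all others are
    reindexed. *)
Lemma qc_des_points (A : qc_ob P) (a : P (qc_carrier A)) :
  qc_des a <-> forall Z (x y : hom Z (qc_carrier A)),
    x \^* a `&` eqv x y <= y \^* a.
Proof.
pose w := some_wprod P [:: qc_carrier A; qc_carrier A].
have E (u : hom (c := prod_completion C) [:: qc_carrier A; qc_carrier A]
     [:: qc_carrier A]) :
    class_at w (u \^* single_elt a) =
    (projT2 (u None) \oc wproj w (projT1 (u None))) \^* a.
  rewrite -[in RHS](single_elt_at a); apply: (@class_at_reidx _ P [:: _; _]
    [:: _] u (single_elt a) w (wprod1 _)).
  by case=> [[]|] /=; rewrite comp1m.
have -> : qc_des a <-> wfst w \^* a `&` eqv (wfst w) (wsnd w) <= wsnd w \^* a.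
  rewrite /qc_des /des (strict_leE w) strict_meetE !E /= !comp1m.
  rewrite -[X in eqv X]compm1 -[X in eqv _ X]compm1 /eqv rel_ptE reidx1.
  by [].
split=> [h Z x y | h]; last exact: h.
have := reidx_mono (wpair w x y) h.
by rewrite reidxI eqv_reidx -!reidx_comp wfst_pair wsnd_pair.
Qed.

Lemma qc_fibP (A : qc_ob P) (a : Q A) Z (x y : hom Z (qc_carrier A)) :
  x \^* sval a `&` eqv x y <= y \^* sval a.
Proof. by have /qc_des_points := svalP a; apply. Qed.

Lemma qc_leE (A : qc_ob P) (a b : Q A) : (a <= b) = (sval a <= sval b).
Proof. by []. Qed.

Lemma qc_meetE (A : qc_ob P) (a b : Q A) : sval (a `&` b) = sval a `&` sval b.
Proof. by []. Qed.

Lemma qc_reidxE (A B : quotient_completion P) (f : qc_prehom A B) (a : Q B) :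
  sval (qc_arr f \^* a) = qc_fun f \^* sval a.
Proof. exact: qc_reidx_class. Qed.

Lemma qc_elt_inj (A : qc_ob P) (a b : Q A) : sval a = sval b -> a = b.
Proof. exact: val_inj. Qed.

End PointsOfQuotientCompletion.

(** * Strict finite products and the elementary structure *)

Section Elementary.
Variables (C : category) (P : biased_elementary C).

Let D := quotient_completion P.
Let Q := quotient_doctrine P.

Lemma eqv_eq_trans (A : D) Z (x y z : hom Z (qc_carrier A)) :
  (\top : P Z) <= eqv (A := A) x y -> (\top : P Z) <= eqv (A := A) y z ->
  (\top : P Z) <= eqv (A := A) x z.
Proof.
by move=> h k; apply: le_trans (eqv_trans (A := A) x y z); rewrite lexI h k.
Qed.

Lemma eqv_cong (A : D) Z (x y x' y' : hom Z (qc_carrier A)) :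
  (\top : P Z) <= eqv (A := A) x x' -> (\top : P Z) <= eqv (A := A) y y' ->
  eqv (A := A) x y = eqv (A := A) x' y'.
Proof.
suff H u v u' v' : (\top : P Z) <= eqv (A := A) u u' ->
    (\top : P Z) <= eqv (A := A) v v' -> eqv (A := A) u v <= eqv (A := A) u' v'.
  move=> hx hy; apply: le_anti; rewrite !H //.
  - exact: le_trans (eqv_sym _ _).
  - exact: le_trans (eqv_sym _ _).
move=> hu hv; apply: le_trans (eqv_trans (A := A) _ u _).
rewrite lexI (le_trans (lex1 _) (le_trans hu (eqv_sym _ _))) /=.
apply: le_trans (eqv_trans (A := A) _ v _).
by rewrite lexI lexx (le_trans (lex1 _) hv).
Qed.

(** Identifying all points turns a weak terminal object into a strict one. *)
Definition total_eqrel (X : C) : pt_eqrel P X.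
Proof.
refine (@PtEqrel _ P X (fun Z _ _ => \top) _ _ _ _) => *;
  by [rewrite reidxT | rewrite ?lex1].
Defined.

Definition qc_term : D := qc_of (total_eqrel (some_wprod P [::])).

Section Product.
Variables A B : D.

Let w := some_wprod P [:: qc_carrier A; qc_carrier B].

(** Points of the weak product are identified when their components are, which makes pairings
    unique. *)
Definition prod_eqrel : pt_eqrel P w.
Proof.
refine (@PtEqrel _ P w (fun Z u v => eqv (A := A) (wfst w \oc u) (wfst w \oc v)
   `&` eqv (A := B) (wsnd w \oc u) (wsnd w \oc v)) _ _ _ _).
- by move=> Z x y Z' k; rewrite reidxI !eqv_reidx !compA.
- move=> Z x y; rewrite lexI.
  by rewrite !(le_trans _ (eqv_eqp _ _)) // eqp_mor.
- by move=> Z x y; apply: leI2; apply: eqv_sym.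
- move=> Z x y z; rewrite lexI; apply/andP; split.
    apply: (le_trans _ (eqv_trans (A := A) _ (wfst w \oc y) _)).
    by apply: leI2; apply: leIl.
  apply: (le_trans _ (eqv_trans (A := B) _ (wsnd w \oc y) _)).
  by apply: leI2; apply: leIr.
Defined.

Definition qc_prod : D := qc_of prod_eqrel.

Lemma eqv_prod Z (u v : hom Z w) : eqv (A := qc_prod) u v =
  eqv (A := A) (wfst w \oc u) (wfst w \oc v) `&`
  eqv (A := B) (wsnd w \oc u) (wsnd w \oc v).
Proof. exact: eqv_of. Qed.

Definition qc_fst0 : qc_prehom qc_prod A.
Proof.
by apply: (@qc_pre _ _ qc_prod A (wfst w)) => Z x y; rewrite eqv_prod leIl.
Defined.

Definition qc_snd0 : qc_prehom qc_prod B.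
Proof.
by apply: (@qc_pre _ _ qc_prod B (wsnd w)) => Z x y; rewrite eqv_prod leIr.
Defined.

Definition qc_pair0 (Z : D) (f : qc_prehom Z A) (g : qc_prehom Z B) :
  qc_prehom Z qc_prod.
Proof.
apply: (@qc_pre _ _ Z qc_prod (wpair w (qc_fun f) (qc_fun g))) => V x y.
by rewrite eqv_prod !compA wfst_pair wsnd_pair lexI !qc_fun_eqv.
Defined.

End Product.

Definition qc_fst (A B : D) : hom (qc_prod A B) A := qc_arr (qc_fst0 A B).
Definition qc_snd (A B : D) : hom (qc_prod A B) B := qc_arr (qc_snd0 A B).
Definition qc_pair (Z A B : D) (f : hom Z A) (g : hom Z B) :
  hom Z (qc_prod A B) := qc_arr (qc_pair0 (qc_repr f) (qc_repr g)).

Lemma qc_pair_uniq (Z A B : D) (f : hom Z A) (g : hom Z B)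
    (h : hom Z (qc_prod A B)) :
  qc_fst A B \oc h = f -> qc_snd A B \oc h = g -> h = qc_pair f g.
Proof.
have [h0 ->] := qc_arrP h.
rewrite -{1}(qc_arr_repr f) -{1}(qc_arr_repr g) !qc_arr_comp.
move=> /qc_arr_eq hf /qc_arr_eq hg; apply/qc_arr_eq.
by rewrite eqv_prod lexI /= wfst_pair wsnd_pair; apply/andP.
Qed.

Lemma qc_fst_pair (Z A B : D) (f : hom Z A) (g : hom Z B) :
  qc_fst A B \oc qc_pair f g = f.
Proof.
rewrite -[RHS]qc_arr_repr qc_arr_comp; apply/qc_arr_eq => /=.
rewrite wfst_pair; exact: eqv_refl.
Qed.

Lemma qc_snd_pair (Z A B : D) (f : hom Z A) (g : hom Z B) :
  qc_snd A B \oc qc_pair f g = g.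
Proof.
rewrite -[RHS]qc_arr_repr qc_arr_comp; apply/qc_arr_eq => /=.
rewrite wsnd_pair; exact: eqv_refl.
Qed.

Definition qc_bang0 (A : D) : qc_prehom A qc_term.
Proof.
apply: (@qc_pre _ _ A qc_term (sval (cid (wprodP (some_wprod P [::])
  (fun i : idx [::] => of_void _ i))))) => Z x y.
by rewrite [X in _ <= X]eqv_of lex1.
Defined.

Definition qc_bang (A : D) : hom A qc_term := qc_arr (qc_bang0 A).

Lemma qc_bang_uniq (A : D) (f : hom A qc_term) : f = qc_bang A.
Proof.
have [f0 ->] := qc_arrP f; apply/qc_arr_eq.
by rewrite [X in _ <= X]eqv_of.
Qed.

Definition qc_prods : finprods D :=
  @Finprods D qc_term qc_bang qc_bang_uniq qc_prod qc_fst qc_snd qc_pair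
    qc_fst_pair qc_snd_pair
    (fun Z A B h => qc_pair_uniq (erefl (qc_fst A B \oc h)) erefl).

Lemma qc_pair_arr (Z A B : D) (f : qc_prehom Z A) (g : qc_prehom Z B) :
  ppair qc_prods (qc_arr f) (qc_arr g) = qc_arr (qc_pair0 f g).
Proof.
apply/esym/qc_pair_uniq; rewrite qc_arr_comp; apply/qc_arr_eq => /=.
  by rewrite wfst_pair; apply: eqv_refl.
by rewrite wsnd_pair; apply: eqv_refl.
Qed.

Let w2 (A : D) := some_wprod P [:: qc_carrier A; qc_carrier A].

(** The delta of [A] is the relation of [A] itself at the generic pair; symmetry and transitivity
    make it invariant under the relation of the product. *)
Lemma qc_delta_des (A : D) :
  qc_des (X := qc_prod A A) (eqv (A := A) (wfst (w2 A)) (wsnd (w2 A))).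
Proof.
apply/qc_des_points => Z x y; rewrite eqv_prod !eqv_reidx.
apply: (le_trans _ (eqv_trans (A := A) _ (wfst (w2 A) \oc x) _)).
rewrite lexI; apply/andP; split.
  by apply: (le_trans _ (eqv_sym _ _)); apply/leIxr/leIl.
apply: (le_trans _ (eqv_trans (A := A) _ (wsnd (w2 A) \oc x) _)).
by apply: leI2 => //; apply: leIr.
Qed.

Definition qc_delta (A : D) : Q (pprod qc_prods A A) :=
  exist (qc_des (X := qc_prod A A)) _ (qc_delta_des A).

Lemma qc_delta_pair (Z A : D) (f g : qc_prehom Z A) :
  sval (ppair qc_prods (qc_arr f) (qc_arr g) \^* qc_delta A)
  = eqv (A := A) (qc_fun f) (qc_fun g).
Proof. by rewrite qc_pair_arr qc_reidxE eqv_reidx wfst_pair wsnd_pair. Qed.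

Lemma qc_delta_refl (A : D) :
  (\top : Q A) <= pdiag qc_prods A \^* qc_delta A.
Proof. by rewrite qc_leE qc_delta_pair; apply: eqv_refl. Qed.

Lemma qc_delta_subst (A : D) (a : Q A) :
  pfst qc_prods A A \^* a `&` qc_delta A <= psnd qc_prods A A \^* a.
Proof. by rewrite qc_leE qc_meetE !qc_reidxE; apply: qc_fibP. Qed.

(** The relation of [qc_prod] is by construction a meet of the relations of its factors, so both
    sides have the same underlying element. *)
Lemma qc_deltaM (A B : D) :
  let AB := pprod qc_prods A B in
  let p1 := pfst qc_prods A B \oc pfst qc_prods AB AB in
  let p2 := psnd qc_prods A B \oc pfst qc_prods AB AB in
  let p3 := pfst qc_prods A B \oc psnd qc_prods AB AB in
  let p4 := psnd qc_prods A B \oc psnd qc_prods AB AB in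
  ppair qc_prods p1 p3 \^* qc_delta A `&` ppair qc_prods p2 p4 \^* qc_delta B
    <= qc_delta AB.
Proof.
cbv zeta; rewrite !qc_arr_comp qc_leE qc_meetE !qc_delta_pair /=.
by rewrite [X in _ <= X]eqv_prod.
Qed.

Definition qc_elementary : elementary Q :=
  @Elementary D Q qc_prods qc_delta qc_delta_refl qc_delta_subst qc_deltaM.

End Elementary.


(** * Discrete objects, and relations of the completion on points *)

Section Quotients.
Variables (C : category) (P : biased_elementary C).

Let D := quotient_completion P.
Let Q := quotient_doctrine P.
Let E := qc_elementary P.

Definition disc_eqrel (Z : C) : pt_eqrel P Z :=
  @PtEqrel C P Z (fun V => @eqp C P V Z)
    (fun _ _ _ _ k => eqp_reidx _ _ _ k) (fun _ _ _ => lexx _)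
    (@eqp_sym C P ^~ Z) (@eqp_trans C P ^~ Z).

Definition disc (Z : C) : D := qc_of (disc_eqrel Z).

(** Every arrow of [C] qualifies, because arrows preserve [eqp] and each object's relation contains
    it. *)
Definition pt0 (A : D) Z (x : hom Z (qc_carrier A)) : qc_prehom (disc Z) A.
Proof.
apply: (@qc_pre _ _ (disc Z) A x) => V u v.
rewrite [X in X <= _]eqv_of; apply: le_trans (eqp_mor P u v x) _.
exact: eqv_eqp.
Defined.

Definition pt (A : D) Z (x : hom Z (qc_carrier A)) : hom (disc Z) A :=
  qc_arr (pt0 x).

Lemma pt_comp (A B : D) (f : qc_prehom A B) Z (x : hom Z (qc_carrier A)) :
  qc_arr f \oc pt x = pt (A := B) (qc_fun f \oc x).
Proof. by rewrite qc_arr_comp; apply/qc_arr_eq/eqv_refl. Qed.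

Section FibreRelations.
Variable A : D.
Implicit Types R S : Q (pprod E A A).

Definition fib_rel R Z (x y : hom Z (qc_carrier A)) : P Z :=
  sval (ppair E (pt (A := A) x) (pt (A := A) y) \^* R).

Let w := some_wprod P [:: qc_carrier A; qc_carrier A].

Lemma fib_relE R Z (x y : hom Z (qc_carrier A)) :
  fib_rel R x y = wpair w x y \^* sval R.
Proof. by rewrite /fib_rel qc_pair_arr qc_reidxE. Qed.

Lemma fib_rel_reidx R Z (x y : hom Z (qc_carrier A)) Z' (k : hom Z' Z) :
  k \^* fib_rel R x y = fib_rel R (x \oc k) (y \oc k).
Proof.
rewrite /fib_rel -(pt_comp (pt0 (A := A) x)) -(pt_comp (pt0 (A := A) y)).
by rewrite -ppair_comp [in RHS]reidx_comp [RHS]qc_reidxE.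
Qed.

Lemma fib_rel_le R S : R <= S <->
  forall Z (x y : hom Z (qc_carrier A)), fib_rel R x y <= fib_rel S x y.
Proof.
split=> [h Z x y|h]; first exact: (reidx_mono _ h).
have T (T : Q (pprod E A A)) : fib_rel T (wfst w) (wsnd w) = sval T.
  rewrite /fib_rel -[RHS]reidx1.
  (* The generic pair is the identity of [w] seen as a point of the product, so reindexing along it
     keeps the underlying element. *)
  have -> : ppair E (pt (A := A) (wfst w)) (pt (A := A) (wsnd w)) =
      pt (A := pprod E A A) (idm w).
    apply/esym/qc_pair_uniq; rewrite pt_comp; apply/qc_arr_eq => /=.
      by rewrite compm1; apply: eqv_refl.
    by rewrite compm1; apply: eqv_refl.
  by rewrite [LHS]qc_reidxE.
by have := h _ (wfst w) (wsnd w); rewrite !T.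
Qed.

(** [R] is a descent datum on the product, hence passes from the pair [x, x] to the equivalent pair
    [x, y]. *)
Lemma eqv_fib_rel R Z (x y : hom Z (qc_carrier A)) :
  (\top : P Z) <= fib_rel R x x -> eqv (A := A) x y <= fib_rel R x y.
Proof.
move=> h; rewrite fib_relE.
apply: (le_trans _ (qc_fibP R (wpair w x x) _)).
rewrite -fib_relE eqv_prod !wfst_pair !wsnd_pair !lexI lexx.
by rewrite (le_trans (lex1 _) h) (le_trans (lex1 _) (eqv_refl x)).
Qed.

End FibreRelations.

Lemma fib_rel_pmap (A B : D) (f g : qc_prehom A B) (S : Q (pprod E B B))
    Z (x y : hom Z (qc_carrier A)) :
  fib_rel (pmap E (qc_arr f) (qc_arr g) \^* S) x y =
  fib_rel S (qc_fun f \oc x) (qc_fun g \oc y).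
Proof.
rewrite /fib_rel -reidx_comp (pmap_pair E (qc_arr f) (qc_arr g) (pt (A := A) x)).
by rewrite !pt_comp.
Qed.

Lemma fib_rel_delta (A : D) Z (x y : hom Z (qc_carrier A)) :
  fib_rel (el_delta E A) x y = eqv (A := A) x y.
Proof. exact: (qc_delta_pair (pt0 (A := A) x) (pt0 (A := A) y)). Qed.

Lemma qc_delta_pmapP (A B : D) (R : Q (pprod E A A)) (f g : qc_prehom A B) :
  R <= pmap E (qc_arr f) (qc_arr g) \^* el_delta E B <->
  forall Z (x y : hom Z (qc_carrier A)),
    fib_rel R x y <= eqv (A := B) (qc_fun f \oc x) (qc_fun g \oc y).
Proof.
rewrite fib_rel_le; split=> h Z x y.
  by have := h Z x y; rewrite fib_rel_pmap fib_rel_delta.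
by rewrite fib_rel_pmap fib_rel_delta.
Qed.

(** * The quotient of an equivalence relation: effectiveness and descent *)

Section QuotientObject.
Variables (A : D) (R : Q (pprod E A A)) (er : is_eqrel E Q R).

Lemma fib_rel_refl Z (x : hom Z (qc_carrier A)) : (\top : P Z) <= fib_rel R x x.
Proof. exact: (eqrel_refl er (pt (A := A) x)). Qed.

Definition fib_eqrel : pt_eqrel P (qc_carrier A).
Proof.
refine (@PtEqrel _ P _ (@fib_rel A R) (@fib_rel_reidx A R) _ _ _).
- move=> Z x y; apply: le_trans (eqv_eqp (A := A) x y) _.
  exact/eqv_fib_rel/fib_rel_refl.
- by move=> Z x y; apply: (eqrel_sym er (pt (A := A) x) (pt (A := A) y)).
- move=> Z x y z.
  exact: (eqrel_trans er (pt (A := A) x) (pt (A := A) y) (pt (A := A) z)).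
Defined.

Definition quot : D := qc_of fib_eqrel.

Lemma eqv_quot Z (x y : hom Z (qc_carrier A)) : eqv (A := quot) x y = fib_rel R x y.
Proof. exact: eqv_of. Qed.

Definition quot_map0 : qc_prehom A quot.
Proof.
apply: (@qc_pre _ _ A quot (idm _)) => Z x y; rewrite !comp1m eqv_quot.
exact/eqv_fib_rel/fib_rel_refl.
Defined.

Definition quot_map : hom A quot := qc_arr quot_map0.

Lemma quot_map_effective : effective (E := E) R quot_map.
Proof.
apply: le_anti; apply/andP; split; apply/fib_rel_le => Z x y;
  by rewrite fib_rel_pmap fib_rel_delta /= !comp1m eqv_quot.
Qed.

Lemma quot_map_quotient : is_quotient (E := E) R quot_map.
Proof.
split=> [|B g]; first by rewrite {1}quot_map_effective.
have [g0 ->] := qc_arrP g => /qc_delta_pmapP hg.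
(* The factorization is [g0] itself, since [quot] only enlarges the relation on the same carrier. *)
have h0P Z (x y : hom Z (qc_carrier quot)) : eqv (A := quot) x y <=
    eqv (A := B) (qc_fun g0 \oc x) (qc_fun g0 \oc y) by rewrite eqv_quot.
exists (qc_arr (qc_pre (A := quot) (B := B) h0P)); split=> [|h].
  by rewrite qc_arr_comp; apply/qc_arr_eq; rewrite /= compm1; apply: eqv_refl.
have [h1 ->] := qc_arrP h; rewrite qc_arr_comp => /qc_arr_eq /= e.
by apply/qc_arr_eq; rewrite /= -[qc_fun h1]compm1.
Qed.

Lemma des_quot_map (a : Q quot) : des E Q R (quot_map \^* a).
Proof.
rewrite /des [in X in _ `&` X]quot_map_effective.
have := reidx_mono (pmap E quot_map quot_map) (el_subst E a).
by rewrite reidxI -!reidx_comp pfst_pair psnd_pair.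
Qed.

Lemma quot_des (a : Q A) : des E Q R a -> qc_des (X := quot) (sval a).
Proof.
move=> da; apply/qc_des_points => Z x y; rewrite eqv_quot.
have := des_reidx (pt (A := A) x) (pt (A := A) y) da.
rewrite qc_leE qc_meetE (qc_reidxE (pt0 (A := A) x)).
by rewrite (qc_reidxE (pt0 (A := A) y)).
Qed.

(** Both inverse maps keep the underlying element of [P (qc_carrier A)]; only the proofs of descent
    change. *)
Lemma quot_map_descent : effective_descent (E := E) R quot_map.
Proof.
exists (fun a => exist (des E Q R) _ (des_quot_map a)).
exists (fun a => exist (qc_des (X := quot)) _ (quot_des (valP a))).
split=> //.
- exact: qc_elt_inj.
- by move=> a b; apply: qc_elt_inj.
- by move=> a; apply: qc_elt_inj; rewrite -[RHS]reidx1; apply: (qc_reidxE quot_map0).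
- by move=> a; apply/val_inj/qc_elt_inj; rewrite [LHS](qc_reidxE quot_map0) /= reidx1.
Qed.

End QuotientObject.

Lemma qc_effective_quotients : has_effective_quotients_of_effective_descent E.
Proof.
move=> A R er; exists (quot er), (quot_map er).
split; [exact: quot_map_quotient | exact: quot_map_effective |
  exact: quot_map_descent].
Qed.

Lemma qc_comprehensive_diagonals : comprehensive_diagonals E.
Proof.
move=> A B f g; have [f0 ->] := qc_arrP f; have [g0 ->] := qc_arrP g.
by rewrite qc_arr_eq qc_leE qc_delta_pair.
Qed.

(** * Restriction along an arrow, strict comprehensions, and quotients split on points *)

Section Restriction.
Variables (A : D) (K : C) (c : hom K (qc_carrier A)).

(** Points of [K] are identified as soon as [c] sends them to equivalent points. This makes [c]
    monic in the completion, hence factorizations through a weak comprehension unique. *)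
Definition restr_eqrel : pt_eqrel P K.
Proof.
refine (@PtEqrel _ P K (fun Z x y => eqv (A := A) (c \oc x) (c \oc y)) _ _ _ _).
- by move=> Z x y Z' k; rewrite eqv_reidx !compA.
- by move=> Z x y; apply: le_trans (eqp_mor P x y c) (eqv_eqp _ _).
- by move=> Z x y; apply: eqv_sym.
- by move=> Z x y z; apply: eqv_trans.
Defined.

Definition restr : D := qc_of restr_eqrel.

Lemma eqv_restr Z (x y : hom Z K) :
  eqv (A := restr) x y = eqv (A := A) (c \oc x) (c \oc y).
Proof. exact: eqv_of. Qed.

Definition restr_map0 : qc_prehom restr A.
Proof. by apply: (@qc_pre _ _ restr A c) => Z x y; rewrite eqv_restr. Defined.

End Restriction.

Lemma qc_strict_full_comprehensions :
  has_weak_full_comprehensions P -> has_strict_full_comprehensions Q.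
Proof.
move=> wfc A a; have [K [c [[ca cw] cf]]] := wfc _ (sval a).
exists (restr (A := A) c), (qc_arr (restr_map0 (A := A) c)); split; last first.
  by move=> b; rewrite !qc_leE qc_reidxE; apply: cf.
split=> [|B f]; first by rewrite qc_leE qc_reidxE.
have [f0 ->] := qc_arrP f; rewrite qc_leE qc_reidxE => /cw[h fE].
have hP Z (x y : hom Z (qc_carrier B)) :
    eqv (A := B) x y <= eqv (A := restr c) (h \oc x) (h \oc y).
  by rewrite eqv_restr !compA -fE qc_fun_eqv.
exists (qc_arr (qc_pre (A := B) (B := restr (A := A) c) hP)); split=> [|k].
  by rewrite qc_arr_comp; apply/qc_arr_eq; rewrite /= -fE; apply: eqv_refl.
have [k0 ->] := qc_arrP k; rewrite qc_arr_comp => /qc_arr_eq /= e.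
by apply/qc_arr_eq; rewrite eqv_restr /= -fE.
Qed.

(* Only the points of [B] have to be lifted: [s] need not respect the
   equivalences. *)
Lemma split_quotient (A B : D) (q : qc_prehom A B)
    (s : hom (qc_carrier B) (qc_carrier A)) :
  (\top : P (qc_carrier B)) <= eqv (A := B) (qc_fun q \oc s) (idm _) ->
  is_quotient (E := E) (pmap E (qc_arr q) (qc_arr q) \^* el_delta E B) (qc_arr q).
Proof.
move=> qs; split=> [|Z g]; first exact: lexx.
have [g0 ->] := qc_arrP g => /qc_delta_pmapP gP.
have {}gP V (x y : hom V (qc_carrier A)) :
    eqv (A := B) (qc_fun q \oc x) (qc_fun q \oc y) <=
    eqv (A := Z) (qc_fun g0 \oc x) (qc_fun g0 \oc y).
  by have := gP V x y; rewrite fib_rel_pmap fib_rel_delta.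
have qsx V (x : hom V (qc_carrier B)) :
    (\top : P V) <= eqv (A := B) (qc_fun q \oc (s \oc x)) x.
  have := reidx_mono x qs; rewrite reidxT eqv_reidx comp1m.
  by rewrite compA.
(* The factorization is [g0] after [s]. It preserves the relations because [gP] only looks at points
   through [q], and [q] undoes [s]. *)
have hP V (x y : hom V (qc_carrier B)) : eqv (A := B) x y <=
    eqv (A := Z) (qc_fun g0 \oc s \oc x) (qc_fun g0 \oc s \oc y).
  rewrite -!compA; apply: (le_trans _ (gP _ _ _)).
  by rewrite (eqv_cong (qsx _ x) (qsx _ y)).
exists (qc_arr (qc_pre (A := B) (B := Z) hP)); split=> [|h].
  rewrite qc_arr_comp; apply/qc_arr_eq; rewrite /= -compA.
  rewrite -{1}[qc_fun g0]compm1; apply: le_trans (gP _ _ _).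
  by rewrite compm1; apply: le_trans (qsx _ _) (eqv_sym _ _).
have [h0 ->] := qc_arrP h; rewrite qc_arr_comp => /qc_arr_eq /= e.
(* Uniqueness: precomposing with [s] gives [g0 s] equivalent to [h0 q s], hence to [h0]. *)
apply/qc_arr_eq => /=; have := reidx_mono s e.
rewrite reidxT eqv_reidx -compA => /eqv_eq_trans; apply.
apply: le_trans qs _; rewrite -{2}[qc_fun h0]compm1; exact: qc_fun_eqv.
Qed.

(** Comparing [q] with [quot_map] gives [h] and [k] with [h k] the identity of [B]. As [quot] has
    the carrier of [A] and [quot_map] is the identity on it, [k] lands in that carrier and [h] acts
    there as [q]. *)
Lemma quotient_section (A B : D) (R : Q (pprod E A A)) (q : qc_prehom A B) :
  is_eqrel E Q R -> is_quotient (E := E) R (qc_arr q) ->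
  exists s : hom (qc_carrier B) (qc_carrier A),
    (\top : P (qc_carrier B)) <= eqv (A := B) (qc_fun q \oc s) (idm _).
Proof.
move=> er [qR qU].
have [_ /(_ _ _ qR)[h [hq _]]] := quot_map_quotient er.
have [qR' _] := quot_map_quotient er; have [k [kq _]] := qU _ _ qR'.
have hk : h \oc k = idm B.
  have [u [_ uU]] := qU _ _ qR.
  by rewrite -(uU (idm B)) ?comp1m // (uU (h \oc k)) // -compA -kq -hq.
move: h k hq kq hk => /qc_arrP[h0 ->] /qc_arrP[k0 ->].
rewrite !qc_arr_comp qc_arr_id => /qc_arr_eq /= hq _ /qc_arr_eq /= hk.
exists (qc_fun k0); apply: eqv_eq_trans hk.
by have := reidx_mono (qc_fun k0) hq; rewrite reidxT eqv_reidx compm1.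
Qed.

(** * Kernels and stability of quotients under pullback *)

Definition meet_eqrel X (e e' : pt_eqrel P X) : pt_eqrel P X.
Proof.
refine (@PtEqrel _ P X (fun Z x y => e Z x y `&` e' Z x y) _ _ _ _).
- by move=> Z x y Z' k; rewrite reidxI !pe_reidx.
- by move=> Z x y; rewrite lexI !pe_eqp.
- by move=> Z x y; apply: leI2; apply: pe_sym.
- move=> Z x y z; rewrite lexI; apply/andP; split.
    apply: (le_trans _ (pe_trans e x y z)); apply: leI2; exact: leIl.
  apply: (le_trans _ (pe_trans e' x y z)); apply: leI2; exact: leIr.
Defined.

(** The delta is reflexive, symmetric and transitive on arbitrary arrows into [B]; the axioms for
    the kernel are the instances at composites with [q]. *)
Lemma qc_kernel_eqrel (A B : D) (q : hom A B) :
  is_eqrel E Q (pmap E q q \^* el_delta E B).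
Proof.
have dr Z (f : hom Z B) : (\top : Q Z) <= ppair E f f \^* el_delta E B.
  by apply/qc_comprehensive_diagonals.
have ds Z (f g : hom Z B) :
    ppair E f g \^* el_delta E B <= ppair E g f \^* el_delta E B.
  have [f0 ->] := qc_arrP f; have [g0 ->] := qc_arrP g.
  by rewrite qc_leE !qc_delta_pair eqv_sym.
have dt Z (f g h : hom Z B) :
    ppair E f g \^* el_delta E B `&` ppair E g h \^* el_delta E B
    <= ppair E f h \^* el_delta E B.
  have [f0 ->] := qc_arrP f; have [g0 ->] := qc_arrP g.
  have [h0 ->] := qc_arrP h.
  by rewrite qc_leE qc_meetE !qc_delta_pair eqv_trans.
split; rewrite -!reidx_comp.
- by rewrite pmap_pair; apply: dr.
- by rewrite pmap_pair; apply: ds.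
- by rewrite !pmap_pair; apply: dt.
Qed.

(* For a section [s] of [q] on points, [id] and [s f] complete [f] and [q] to a
   commuting square on the object [Y], so the pullback [q'] has a section on
   points too. *)
Lemma qc_stable_quotients : has_stable_quotients E.
Proof.
move=> A R B q er; have [q0 ->] := qc_arrP q => qQ.
have [s qs] := quotient_section er qQ.
move=> B' A' f q' f'; have [f0 ->] := qc_arrP f; have [q1 ->] := qc_arrP q'.
move=> [_ pb].
pose sf := s \oc qc_fun f0.
(* The carrier of [B'] with the largest relation for which both the identity into [B'] and [sf] into
   [A] are arrows. *)
pose Y : D := qc_of (meet_eqrel (restr_eqrel (A := B') (idm _)) (restr_eqrel (A := A) sf)).
have YE V (x y : hom V (qc_carrier B')) : eqv (A := Y) x y =
    eqv (A := B') x y `&` eqv (A := A) (sf \oc x) (sf \oc y).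
  by rewrite eqv_of /= !comp1m.
have aP V (x y : hom V (qc_carrier Y)) : eqv (A := Y) x y <=
    eqv (A := B') (idm _ \oc x) (idm _ \oc y) by rewrite YE !comp1m leIl.
have bP V (x y : hom V (qc_carrier Y)) : eqv (A := Y) x y <=
    eqv (A := A) (sf \oc x) (sf \oc y) by rewrite YE leIr.
have [|k [[kq _] _]] := pb Y (qc_arr (qc_pre aP)) (qc_arr (qc_pre bP)).
  rewrite !qc_arr_comp; apply/qc_arr_eq => /=.
  rewrite compm1 compA; have := reidx_mono (qc_fun f0) qs.
  by rewrite reidxT eqv_reidx comp1m => /le_trans; apply; apply: eqv_sym.
have [k0 kE] := qc_arrP k.
(* Equality of arrows is tested in the codomain, so [k0] splits [q1] over the points of [B']
   although [k] is only defined on [Y]. *)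
move: kq; rewrite kE qc_arr_comp => /qc_arr_eq /= /split_quotient qQ'.
by exists (pmap E (qc_arr q1) (qc_arr q1) \^* el_delta E B'); split=> //;
  apply: qc_kernel_eqrel.
Qed.

End Quotients.

Theorem theorem6p6 (C : category) (P : biased_elementary C) :
  exists E : elementary (quotient_doctrine P),
    has_effective_quotients_of_effective_descent E /\
    (has_weak_full_comprehensions P ->
     biased_comprehensive_diagonals P ->
     [/\ has_strict_full_comprehensions (quotient_doctrine P),
         comprehensive_diagonals E
       & has_stable_quotients E]).
Proof.
exists (qc_elementary P); split; first exact: qc_effective_quotients.
move=> wfc _; split; [exact: qc_strict_full_comprehensions |
  exact: qc_comprehensive_diagonals | exact: qc_stable_quotients].
Qed.
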